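(* Let $(A,\mathfrak m)$ be an $\mathfrak m$-adically complete Noetherian local ring with infinite residue field $A/\mathfrak m$, let $d=\dim A$, and let $M$ be a finitely generated $A$-module with $\dim_A M=d\ge2$. Suppose that $M$ is unmixed. Let $Q$ be a parameter ideal in $A$. Then the set $$\Lambda_Q^2(M)=\{\mathrm{e}_{\mathfrak q}^2(M)\mid \mathfrak q \text{ is a parameter ideal in } A \text{ such that } \overline{\mathfrak q}=\overline{Q}\}$$ is finite.
   Context: For an ideal $J$ of $A$, $\overline J$ denotes the integral closure of $J$ in $A$. A parameter ideal of $A$ is an ideal generated by a system of parameters of $A$. Hilbert coefficients: for an $\mathfrak m$-primary ideal $I$ and a finitely generated $A$-module $M$ with $s=\dim_A M$, the integers $\mathrm{e}_I^i(M)$, $0\le i\le s$, are defined by $\ell_A(M/I^{n+1}M)=\sum_{i=0}^{s}(-1)^i\mathrm{e}_I^i(M)\binom{n+s-i}{s-i}$ for all $n\gg0$, where $\ell_A$ denotes length. $M$ is called unmixed if $\dim A/\mathfrak p=\dim_A M$ for all $\mathfrak p\in\operatorname{Ass}_A M$. *)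

(* Defs.v *)
(* MathComp, with sets, finiteness and choice from mathcomp-classical *)
From HB Require Import structures.
From mathcomp Require Import all_boot all_order all_algebra.
From mathcomp Require Import boolp classical_sets functions cardinality.

Set Implicit Arguments.
Unset Strict Implicit.
Unset Printing Implicit Defensive.
Import GRing.Theory.
Local Open Scope classical_set_scope.
Local Open Scope ring_scope.

(* The supremum of the lengths k of chains X_0 < X_1 < ... < X_k in the family
   P, ordered by inclusion, exists and equals n. No n qualifies when P is empty
   or when the lengths are unbounded. *)
Definition chain_of_length (T : Type) (P : set (set T)) (k : nat) : Prop :=
  exists X : nat -> set T,
    (forall i, (i <= k)%N -> P (X i)) /\
    (forall i, (i < k)%N -> X i `<` X i.+1).

Definition chain_dim (T : Type) (P : set (set T)) (n : nat) : Prop :=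
  chain_of_length P n /\ forall k, chain_of_length P k -> (k <= n)%N.

Section Submodules.
Context {A : comNzRingType} {V : lmodType A}.

Definition submodule (N : set V) : Prop := GRing.submod_closed [in N].

Definition submod_span (X : set V) : set V := smallest submodule X.

Definition finitely_generated (N : set V) : Prop :=
  exists s : seq V, N = submod_span [set` s].

Definition smul (I : set A) (N : set V) : set V :=
  submod_span [set a *: x | a in I & x in N].

Definition quot_length (N : set V) (l : nat) : Prop :=
  chain_dim [set L | submodule L /\ N `<=` L] l.

End Submodules.

Section Ideals.
Context {A : comNzRingType}.

(* Ideals are the submodules of the regular module A^o; the unit ideal is
   allowed. *)
Definition ideal (J : set A) : Prop := submodule (J : set A^o).

Definition ideal_gen (X : set A) : set A := submod_span (X : set A^o).

Fixpoint ideal_pow (J : set A) (n : nat) : set A :=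
  if n is k.+1 then smul J (ideal_pow J k : set A^o) else setT.

Definition noetherian : Prop :=
  forall J : set A, ideal J -> finitely_generated (J : set A^o).

Definition prime_ideal (p : set A) : Prop :=
  idealr_closed [in p] /\ prime_idealr_closed [in p].

Definition maximal_ideal (m : set A) : Prop :=
  [/\ ideal m, ~ m 1 &
      forall J, ideal J -> ~ J 1 -> m `<=` J -> J = m].

Definition local_ring (m : set A) : Prop :=
  maximal_ideal m /\ forall n, maximal_ideal n -> n = m.

Definition quotient_set (J : set A) : set (set A) :=
  range (fun a : A => [set b | J (b - a)]).

(* The canonical map from A to the inverse limit of the A/J^n is injective and
   surjective; an element of the limit is given by a compatible sequence of
   representatives u n of its components in A/J^n. *)
Definition adically_complete (J : set A) : Prop :=
  (\bigcap_n ideal_pow J n = [set 0]) /\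
  (forall u : nat -> A, (forall n, ideal_pow J n (u n.+1 - u n)) ->
     exists a, forall n, ideal_pow J n (a - u n)).

(* Krull dimension of A/J; no n qualifies when J is the unit ideal. *)
Definition quot_dim (J : set A) (n : nat) : Prop :=
  chain_dim [set p | prime_ideal p /\ J `<=` p] n.

Definition ring_dim (n : nat) : Prop := quot_dim [set 0] n.

Definition radical (J : set A) : set A := [set a | exists n, J (a ^+ n)].

Definition primary_ideal (J : set A) : Prop :=
  [/\ ideal J, ~ J 1 &
      forall a b, J (a * b) -> J a \/ radical J b].

Definition primary_to (m J : set A) : Prop :=
  primary_ideal J /\ radical J = m.

Definition system_of_parameters (m : set A) (x : seq A) : Prop :=
  ring_dim (size x) /\ primary_to m (ideal_gen [set` x]).

Definition parameter_ideal (m q : set A) : Prop :=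
  exists2 x : seq A, system_of_parameters m x & q = ideal_gen [set` x].

Definition integral_closure (J : set A) : set A :=
  [set x | exists n (a : nat -> A),
     [/\ (0 < n)%N,
         forall i, (0 < i <= n)%N -> ideal_pow J i (a i) &
         x ^+ n + \sum_(1 <= i < n.+1) a i * x ^+ (n - i) = 0]].

End Ideals.

Arguments noetherian : clear implicits.
Arguments ring_dim : clear implicits.

Section Modules.
Context {A : comNzRingType} (M : lmodType A).

Definition finite_module : Prop := finitely_generated [set: M].

Definition annihilator : set A := [set a | forall x : M, a *: x = 0].

Definition module_dim (n : nat) : Prop := quot_dim annihilator n.

Definition associated_prime (p : set A) : Prop :=
  prime_ideal p /\ exists x : M, p = [set a | a *: x = 0].

(* The equivalence says that the dimensions of A/p and of M are equal. *)
Definition unmixed : Prop :=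
  forall p, associated_prime p -> forall n, quot_dim p n <-> module_dim n.

(* The identity
     length (M/I^(n+1)M) = \sum_(i <= s) (-1)^i e_i binom(n+s-i, s-i)
   holds, with finite length, for all large n. *)
Definition hilbert_expansion (I : set A) (s : nat) (e : nat -> int) : Prop :=
  exists n0, forall n, (n0 <= n)%N ->
    exists2 l : nat,
      quot_length (smul (ideal_pow I n.+1) [set: M]) l &
      l%:Z = \sum_(i < s.+1)
               (-1) ^+ i * e i * ('C(n + s - i, s - i))%:Z.

(* The i-th Hilbert coefficient of M with respect to I, with s = dim M and
   i <= s. It is unique, as the binomials are linearly independent functions of
   large n; the junk value 0 is taken only when it does not exist. *)
Definition hilbert_coef (I : set A) (i : nat) : int :=
  xget 0 [set c | exists s (e : nat -> int),
    [/\ module_dim s, (i <= s)%N, hilbert_expansion I s e & c = e i]].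

End Modules.

(* Main.v *)
Require Import Defs.
From mathcomp Require Import all_boot all_order all_algebra.
From mathcomp Require Import boolp classical_sets functions cardinality.
From mathcomp Require Import zify ring.

(* Let J be generated by the integral closure of Q. Every q in the family is a
   reduction of J, and Noetherianity of a polynomial ring over A gives a single r
   with J^(r+1) = q J^r for all of them. Hence, for p and q in the family,
     q^(n+1+r) M <= J^(n+1+r) M <= p^(n+1) M    for all n.
   Both successive quotients are graded pieces of modules generated in degree 0,
   by a module of length bounded independently of p and q, over a polynomial ring
   in d variables. Filtering by cyclic modules, each of which is either a full
   polynomial ring over a residue field or a proper quotient of it, their lengths
   are c binom(n+d-1, d-1) + eps(n) with 0 <= c bounded and
   0 <= eps(n) = O(n^(d-2)). Comparing coefficients of the Hilbert polynomials of p
   and q gives e_0(p) = e_0(q), then finitely many values for e_1, and a one-sided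
   bound on e_2(q) - e_2(p); exchanging p and q gives the other side. *)

Set Implicit Arguments.
Unset Strict Implicit.
Unset Printing Implicit Defensive.

(** Each q has its own exponent r, and the family is infinite, so the obstacle is to choose r
    independently of q. The coefficients that express generators of q through generators of J are
    replaced by indeterminates. The ideals of those g that carry J^(n+1) into the generic q J^n
    increase with n, and the index at which they become stationary serves every specialisation.

    With r fixed, the modules generating in degree 0 are J^(r+1)M / q^(r+1)M and pM / J^(r+1)M.
    Their lengths are at most those of M / J^(2r+1)M and M / J^(r+1)M, in which neither p nor q
    occurs. This bounds c only: the constant hidden in O(n^(d-2)) may change with p and q. For a
    fixed pair it still forces eps to be a polynomial of degree at most d-2 for large n, with a
    nonnegative coefficient in that degree, whence an inequality for e_2 and not a formula. The
    bound on e_2(q) from below contains e_1(q), which is why the range of e_1 has to be bounded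
    before. *)

Local Open Scope classical_set_scope.

(** * Submodules, spans and products of ideals with submodules *)

Section SubmoduleTheory.
Local Open Scope ring_scope.
Import GRing.Theory.
Context {A : comNzRingType} {V : lmodType A}.
Implicit Types (N K X Y : set V) (I : set A).

Lemma submoduleP N :
  submodule N <-> N 0 /\ forall a u v, N u -> N v -> N (a *: u + v).
Proof.
split=> [[N0 NL]|[N0 NL]].
  split; first by move: N0; rewrite inE.
  by move=> a u v Nu Nv; have := NL a u v; rewrite !inE; exact.
split; first by rewrite inE.
by move=> a u v; rewrite !inE; exact: NL.
Qed.

Lemma submodule0 N : submodule N -> N 0.
Proof. by case/submoduleP. Qed.

Lemma submoduleZ N a u : submodule N -> N u -> N (a *: u).
Proof.
by case/submoduleP=> N0 NL Nu; rewrite -[_ *: _]addr0; exact: NL.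
Qed.

Lemma submoduleD N u v : submodule N -> N u -> N v -> N (u + v).
Proof. by case/submoduleP=> N0 NL Nu Nv; rewrite -[u]scale1r; exact: NL. Qed.

Lemma submoduleB N u v : submodule N -> N u -> N v -> N (u - v).
Proof.
by move=> sN Nu Nv; rewrite -scaleN1r; apply: submoduleD => //;
  exact: submoduleZ.
Qed.

Lemma submoduleT : submodule [set: V].
Proof. exact/submoduleP. Qed.

Lemma submoduleI N K : submodule N -> submodule K -> submodule (N `&` K).
Proof.
move=> /submoduleP[N0 NL] /submoduleP[K0 KL]; apply/submoduleP; split=> //.
by move=> a u v [? ?] [? ?]; split; [apply: NL|apply: KL].
Qed.

Lemma submodule_preZ N a : submodule N -> submodule [set v | N (a *: v)].
Proof.
move=> /submoduleP[N0 NL]; apply/submoduleP; split=> [|b u v /= Nu Nv].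
  by rewrite /= scaler0.
by rewrite scalerDr scalerA mulrC -scalerA; exact: NL.
Qed.

Lemma submodule_span X : submodule (submod_span X).
Proof.
apply/submoduleP; split=> [N [/submoduleP[] //]|a u v Xu Xv N [sN XN]].
by case/submoduleP: (sN) => N0 NL; apply: NL; [apply: Xu|apply: Xv].
Qed.

Lemma sub_span X : X `<=` submod_span X.
Proof. exact: sub_gen_smallest. Qed.

Lemma span_min X N : submodule N -> X `<=` N -> submod_span X `<=` N.
Proof. exact: smallest_sub. Qed.

Lemma span_le X Y : X `<=` Y -> submod_span X `<=` submod_span Y.
Proof.
by move=> XY; apply: span_min (@submodule_span _) (subset_trans XY (@sub_span _)).
Qed.

Lemma span_eq X N : X `<=` N -> submodule N ->
  (forall K, submodule K -> X `<=` K -> N `<=` K) -> submod_span X = N.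
Proof.
move=> XN sN NK; apply/seteqP; split; first exact: span_min.
by apply: NK (@submodule_span _) (@sub_span _).
Qed.

Definition addset N K : set V := [set u + v | u in N & v in K].

Lemma submodule_addset N K :
  submodule N -> submodule K -> submodule (addset N K).
Proof.
move=> sN sK; apply/submoduleP; split.
  by exists 0; [exact: submodule0|exists 0; [exact: submodule0|rewrite addr0]].
move=> a _ _ [u Nu [v Kv <-]] [u' Nu' [v' Kv' <-]].
exists (a *: u + u'); first by apply: submoduleD => //; exact: submoduleZ.
exists (a *: v + v'); first by apply: submoduleD => //; exact: submoduleZ.
by rewrite scalerDr addrACA.
Qed.

Lemma sub_addsetl N K : submodule K -> N `<=` addset N K.
Proof.
by move=> sK u Nu; exists u => //; exists 0; [exact: submodule0|rewrite addr0].
Qed.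

Lemma sub_addsetr N K : submodule N -> K `<=` addset N K.
Proof.
by move=> sN u Ku; exists 0; [exact: submodule0|exists u; rewrite ?add0r].
Qed.

Lemma addset_min N K L :
  submodule L -> N `<=` L -> K `<=` L -> addset N K `<=` L.
Proof.
by move=> sL NL KL _ [u /NL ? [v /KL ? <-]]; exact: submoduleD.
Qed.

Lemma span_setU1 N u z : submodule N ->
  submod_span (N `|` [set u]) z -> exists a, N (z - a *: u).
Proof.
move=> sN sz; pose L := [set z | exists a, N (z - a *: u)].
suff sL : submodule L.
  suff: L z by []; apply: (span_min sL) sz => {}z [Nz|->].
    by exists 0; rewrite scale0r subr0.
  by exists 1; rewrite scale1r subrr; exact: submodule0.
apply/submoduleP; split; first by exists 0; rewrite scale0r subr0;
  exact: submodule0.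
move=> a v w [b Nv] [c Nw]; exists (a * b + c).
rewrite scalerDl -scalerA opprD addrACA -scalerBr.
by apply: submoduleD => //; exact: submoduleZ.
Qed.

Lemma spanP (s : seq V) z : submod_span [set` s] z ->
  exists c : nat -> A, z = \sum_(i < size s) c i *: s`_i.
Proof.
move=> sz; pose L := [set z | exists c : nat -> A,
  z = \sum_(i < size s) c i *: s`_i].
suff sL : submodule L.
  suff: L z by []; apply: (span_min sL) sz => {z} y /= ys.
  have iy : (index y s < size s)%N by rewrite index_mem.
  exists (fun i => (i == index y s)%:R).
  rewrite (bigD1 (Ordinal iy)) //= eqxx scale1r nth_index // big1 ?addr0 // =>
    i /eqP ii.
  by case: eqP => [e|]; rewrite ?scale0r //; case: ii; exact: val_inj.
apply/submoduleP; split.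
  by exists (fun=> 0); rewrite big1 // => i _; rewrite scale0r.
move=> a _ _ [b ->] [c ->]; exists (fun i => a * b i + c i).
rewrite scaler_sumr -big_split /=; apply: eq_bigr => i _.
by rewrite scalerDl scalerA.
Qed.

Lemma submodule_sum N n (F : 'I_n -> V) :
  submodule N -> (forall i, N (F i)) -> N (\sum_i F i).
Proof.
move=> sN NF; apply: (big_ind N); [exact: submodule0| |by []].
by move=> *; exact: submoduleD.
Qed.

Lemma span_finite X y : submod_span X y ->
  exists2 s : seq V, [set` s] `<=` X & submod_span [set` s] y.
Proof.
pose L := [set y | exists2 s : seq V, [set` s] `<=` X & submod_span [set` s] y].
suff sL : submodule L.
  move=> sy; suff: L y by []; apply: (span_min sL) sy => {}y Xy; exists [:: y].
    by move=> z /=; rewrite inE => /eqP ->.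
  by apply: sub_span; rewrite /= inE.
apply/submoduleP; split; first by exists [::] => //;
  exact: (submodule0 (submodule_span _)).
move=> a u v [s sX su] [t tX tv]; exists (s ++ t).
  by move=> z /=; rewrite mem_cat => /orP[/sX|/tX].
apply: (submoduleD (submodule_span _)).
  apply: (submoduleZ _ (submodule_span _)).
  by apply: span_le su => z /= zs; rewrite mem_cat zs.
by apply: span_le tv => z /= zs; rewrite mem_cat zs orbT.
Qed.

(** Noetherianity yields finitely many generators of an ideal without placing them in a prescribed
    generating set. This trades them for finitely many members of [X]; it is applied with [X] an
    integral closure, so that every generator is integral. *)
Lemma span_finite_seq X (s : seq V) : [set` s] `<=` submod_span X ->
  exists2 t : seq V, [set` t] `<=` X & [set` s] `<=` submod_span [set` t].
Proof.
elim: s => [|y s IH] sX; first by exists [::].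
have [|t tX st] := IH; first by move=> z zs; apply: sX; rewrite /= inE zs orbT.
have [|t' t'X yt'] := @span_finite X y; first by apply: sX; rewrite /= inE eqxx.
exists (t' ++ t); first by move=> z /=; rewrite mem_cat => /orP[/t'X|/tX].
move=> z /=; rewrite inE => /predU1P[->|/st].
  by apply: span_le yt' => w /= wt; rewrite mem_cat wt.
by apply: span_le => w /= wt; rewrite mem_cat wt orbT.
Qed.

Lemma submodule_smul I N : submodule (smul I N).
Proof. exact: submodule_span. Qed.

Lemma smul_in I N a x : I a -> N x -> smul I N (a *: x).
Proof. by move=> Ia Nx; apply: sub_span; exists a => //; exists x. Qed.

Lemma smul_min I N K : submodule K ->
  (forall a x, I a -> N x -> K (a *: x)) -> smul I N `<=` K.
Proof. by move=> sK IK; apply: span_min => // _ [a Ia [x Nx <-]]; exact: IK.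
  Qed.

Lemma smul_le I J N K : I `<=` J -> N `<=` K -> smul I N `<=` smul J K.
Proof.
move=> IJ NK; apply: smul_min (submodule_smul _ _) _ => a x /IJ Ja /NK Kx.
exact: smul_in.
Qed.

Lemma smul_sub I N : submodule N -> smul I N `<=` N.
Proof. by move=> sN; apply: smul_min => // a x _; exact: submoduleZ. Qed.

End SubmoduleTheory.

Section SmulTheory.
Local Open Scope ring_scope.
Import GRing.Theory.
Context {A : comNzRingType} {V : lmodType A}.
Implicit Types (N K : set V) (I J : set A).

Lemma submodule_annihilated N v : submodule N -> submodule [set a : A^o |
  N (a *: v)].
Proof.
move=> /submoduleP[N0 NL]; apply/submoduleP; split=> [|b a c /= Nu Nv].
  by rewrite /= scale0r.
by rewrite scalerDl -scalerA; exact: NL.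
Qed.

Lemma smul_genl (X : set A) N K : submodule K ->
  (forall a x, X a -> N x -> K (a *: x)) -> smul (ideal_gen X) N `<=` K.
Proof.
move=> sK XK; apply: smul_min => // a x Xa Nx.
by move: a Xa; apply: span_min (submodule_annihilated _ sK) _ => a Xa;
  exact: XK.
Qed.

Lemma smulA I J N : smul (smul I (J : set A^o)) N = smul I (smul J N).
Proof.
apply/seteqP; split.
  apply: smul_genl (submodule_smul _ _) _ => _ x [a Ia [b Jb <-]] Nx.
  by rewrite -scalerA; apply: smul_in => //; exact: smul_in.
apply: smul_min (submodule_smul _ _) _ => a x Ia; move: x.
apply: smul_min (submodule_preZ _ (submodule_smul _ _)) _ => b x Jb Nx /=.
rewrite scalerA; apply: smul_in Nx; exact: (@smul_in).
Qed.

End SmulTheory.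

(** * Suprema of chain lengths *)

Section Chains.
Context {T : Type}.
Implicit Types (P : set (set T)) (X Y : set T).

(** The inductive form of [chain_of_length], indexed by the top member of the chain, so that chains
    are built and analysed by adding one member on top. *)
Inductive strict_chain P : nat -> set T -> Prop :=
| strict_chain0 X : P X -> strict_chain P 0 X
| strict_chainS k X Y : strict_chain P k X -> P Y -> X `<` Y ->
    strict_chain P k.+1 Y.

Lemma strict_chain_in P k X : strict_chain P k X -> P X.
Proof. by case. Qed.

Lemma strict_chain_pred P k Y : strict_chain P k.+1 Y ->
  exists2 X, strict_chain P k X & X `<` Y.
Proof.
move eK : k.+1 => k' cY; case: cY eK => // {}k' X {}Y cX PY XY [->].
by exists X.
Qed.

Lemma strict_chain_le P P' k X : P `<=` P' ->
  strict_chain P k X -> strict_chain P' k X.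
Proof.
move=> PP'; elim=> {k X} [X /PP'|k X Y _ IH /PP' P'Y XY].
  exact: strict_chain0.
exact: strict_chainS IH _ _.
Qed.

Lemma chain_of_lengthP P k :
  chain_of_length P k <-> exists X, strict_chain P k X.
Proof.
split=> [[X [PX XS]]|[X]].
  exists (X k); elim: k PX XS => [|k IH] PX XS; first exact/strict_chain0/PX.
  apply: strict_chainS (XS k _) => //; last exact: PX.
  by apply: IH => i ik; [apply: PX; lia|apply: XS; lia].
suff: strict_chain P k X -> exists F : nat -> set T,
    [/\ forall i, (i <= k)%N -> P (F i), forall i, (i < k)%N -> F i `<` F i.+1
      & F k = X].
  by move=> H /H[F [? ? _]]; exists F.
elim=> {k X} [X PX|k X Y _ [F [PF FS FX]] PY XY].
  by exists (fun=> X); split=> [i _|i|].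
exists (fun i => if (i <= k)%N then F i else Y); split=> [i _|i|].
- by case: ifP => // /PF.
- rewrite ltnS => ik; rewrite ik; case: ifPn => [|nik]; first exact: FS.
  have -> : i = k by lia.
  by rewrite FX.
- by rewrite ltnn.
Qed.

Lemma strict_chain_length P k X l : strict_chain P k X -> chain_dim P l ->
  (k <= l)%N.
Proof. by move=> cX [_]; apply; apply/chain_of_lengthP; exists X. Qed.

Lemma chain_dim_uniq P k l : chain_dim P k -> chain_dim P l -> k = l.
Proof. by move=> [Pk km] [Pl lm]; apply/eqP; rewrite eqn_leq lm ?km. Qed.

Lemma chain_dim_sub P P' l X : P `<=` P' -> P X -> chain_dim P' l ->
  exists2 k, (k <= l)%N & chain_dim P k.
Proof.
move=> PP' PX lP'; pose Q := [pred k | `[< chain_of_length P k >]].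
have Q0 : Q 0 by apply/asboolP/chain_of_lengthP; exists X; exact: strict_chain0.
have Ql k : Q k -> (k <= l)%N.
  move=> /asboolP/chain_of_lengthP[Y /(strict_chain_le PP')] cY.
  exact: strict_chain_length cY lP'.
case: (ex_maxnP (ex_intro _ 0 Q0) Ql) => k Qk kmax.
exists k; first exact: Ql.
by split=> [|j Pj]; [exact/asboolP|apply/kmax/asboolP].
Qed.

End Chains.

(** * Relative length of one submodule over another *)

Section Length.
Local Open Scope ring_scope.
Import GRing.Theory.
Context {A : comNzRingType} {V : lmodType A}.
Implicit Types (W X Y Z L : set V).

(** The submodules of Y/X, seen in [V]; lengths of subquotients are thus measured without forming
    quotient modules. *)
Definition between X Y : set (set V) :=
  [set L | [/\ submodule L, X `<=` L & L `<=` Y]].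

Definition rel_length X Y (l : nat) : Prop := chain_dim (between X Y) l.

Lemma quot_lengthE X l : quot_length X l = rel_length X [set: V] l.
Proof.
rewrite /quot_length /rel_length; congr chain_dim; apply/seteqP.
by split=> L [? ?]; split.
Qed.

Lemma rel_length_refl X : submodule X -> rel_length X X 0.
Proof.
move=> sX; split.
  by apply/chain_of_lengthP; exists X; apply: strict_chain0; split.
move=> k /chain_of_lengthP[_ [//|{}k L Y /strict_chain_in[_ XL _] [_ _ YX] [_ nYL]]].
by case: nYL; exact: subset_trans XL.
Qed.

Lemma rel_length_add X Y Z k l : submodule Y -> submodule Z -> X `<=` Y ->
  Y `<=` Z ->
  rel_length X Y k -> rel_length Y Z l -> rel_length X Z (k + l).
Proof.
move=> sY sZ XY YZ lXY lYZ; split.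
  case: lXY lYZ => /chain_of_lengthP[K cK] _ [/chain_of_lengthP[L cL] _].
  apply/chain_of_lengthP.
  suff [K' _ cK'] : exists2 K', K' `<=` L &
    strict_chain (between X Z) (k + l) K'.
    by exists K'.
  elim: cL => {l L} [L [sL YL LZ]|l L M _ [K' K'L cK'] [sM YM MZ] [LM nML]].
    exists K; first by case: (strict_chain_in cK) => _ _ KY;
      exact: subset_trans YL.
    rewrite addn0; apply: strict_chain_le cK => N [sN XN NY]; split=> //.
    exact: subset_trans YZ.
  exists M => //; rewrite addnS; apply: strict_chainS cK' _ _.
    by split=> //; exact: subset_trans YM.
  split; first exact: subset_trans LM.
  by move=> MK'; apply: nML; exact: subset_trans K'L.
move=> n /chain_of_lengthP[K cK].
(* A chain between [X] and [Z] is traced on [Y] by intersection and by sum. Each strict step must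
   enlarge at least one of the two traces. *)
suff [i [j [cKi cKj nij]]] : exists i j,
    [/\ strict_chain (between X Y) i (K `&` Y),
        strict_chain (between Y Z) j (addset K Y) & (n <= i + j)%N].
  have := strict_chain_length cKi lXY; have := strict_chain_length cKj lYZ; lia.
have bI L : between X Z L -> between X Y (L `&` Y).
  move=> [sL XL LZ]; split; first exact: submoduleI.
    by move=> z Xz; split; [exact: XL|exact: XY].
  exact: subIsetr.
have bD L : between X Z L -> between Y Z (addset L Y).
  by move=> [sL XL LZ]; split; [exact: submodule_addset|exact: sub_addsetr|exact: addset_min].
elim: cK => {n K} [K bK|n K L cK [i [j [cI cD nij]]] bL [KL nLK]].
  by exists 0, 0; split=> //; apply: strict_chain0; [exact: bI|exact: bD].
have bK := strict_chain_in cK; case: (bK) => sK XK KZ; case: (bL) => sL XL LZ.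
have KLI : K `&` Y `<=` L `&` Y by exact: setSI.
have KLD : addset K Y `<=` addset L Y.
  apply: addset_min (submodule_addset sL sY) _ (sub_addsetr sL).
  by apply: subset_trans KL _; exact: sub_addsetl.
have grow (P : set (set V)) p K1 K2 : strict_chain P p K1 -> P K2 ->
  K1 `<=` K2 ->
    strict_chain P p K2 \/ strict_chain P p.+1 K2.
  move=> cK1 PK2 K12; have [K21|nK21] := pselect (K2 `<=` K1).
    by left; rewrite -(_ : K1 = K2) //; apply/seteqP.
  by right; apply: strict_chainS cK1 PK2 _.
have [LKD|nLKD] := pselect (addset L Y `<=` addset K Y); last first.
  have cD' : strict_chain (between Y Z) j.+1 (addset L Y).
    exact: strict_chainS cD (bD _ bL) _.
  case: (grow _ _ _ _ cI (bI _ bL) KLI) => cI'.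
    by exists i, j.+1; split=> //; lia.
  by exists i.+1, j.+1; split=> //; lia.
have eD : addset K Y = addset L Y by exact/seteqP.
exists i.+1, j; split; [|by rewrite -eD|by lia].
apply: strict_chainS cI (bI _ bL) _; split=> // LKI; apply: nLK => z Lz.
(* The modular law: with equal sums and equal intersections with [Y], the submodules [K] and [L]
   would coincide. *)
have [u Ku [v Yv uvz]] := LKD z (sub_addsetl sY Lz).
have -> : z = u + (z - u) by rewrite addrC subrK.
apply: (submoduleD sK Ku); apply: (LKI (z - u) _).1; split.
  by apply: submoduleB => //; exact: KL.
by rewrite -uvz addrC addKr.
Qed.

Lemma rel_length_split X Y Z l : submodule X -> submodule Y -> submodule Z ->
    X `<=` Y -> Y `<=` Z -> rel_length X Z l ->
  exists i j, [/\ rel_length X Y i, rel_length Y Z j & l = (i + j)%N].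
Proof.
move=> sX sY sZ XY YZ lXZ.
have [||i _ lXY] := chain_dim_sub (P := between X Y) (X := X) _ _ lXZ.
- by move=> L [? ? LY]; split=> //; exact: subset_trans YZ.
- by split.
have [||j _ lYZ] := chain_dim_sub (P := between Y Z) (X := Y) _ _ lXZ.
- by move=> L [? YL ?]; split=> //; exact: subset_trans YL.
- by split.
exists i, j; split=> //; apply: chain_dim_uniq lXZ _.
exact: (rel_length_add sY sZ).
Qed.

(* For [v] outside [X], this says that [X + Av] covers [X]. *)
Definition simple_over X (v : V) : Prop :=
  forall a, X (a *: v) \/ exists b, X (v - b *: (a *: v)).

Lemma simple_over_le X Y v : X `<=` Y -> simple_over X v -> simple_over Y v.
Proof.
by move=> XY sv a; case: (sv a) => [/XY|[b /XY]]; [left|right; exists b].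
Qed.

(** The boolean is read as the number 0 or 1, so that adding generators one at a time turns a length
    into a count. A submodule strictly above [X] contains some [a *: v] outside [X] modulo [X],
    hence [v] by simplicity. *)
Lemma rel_length_simple X v : submodule X -> simple_over X v ->
  rel_length X (submod_span (X `|` [set v])) (v \notin X).
Proof.
move=> sX simv; set Y := submod_span _.
have XY : X `<=` Y by apply: subset_trans (@sub_span _ _ _); left.
have Yv : Y v by apply: sub_span; right.
have [Xv|/negP nXv] := boolP (v \in X); rewrite /=.
  have -> : Y = X; last exact: rel_length_refl.
  apply: span_eq => // [z [//|->]|K _ XK]; first exact: set_mem.
  by apply: subset_trans XK => z ?; left.
have {}nXv : ~ X v by move=> /mem_set.
split.
  apply/chain_of_lengthP; exists Y; apply: (strict_chainS (X := X)).
  - by apply: strict_chain0; split.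
  - by split=> //; exact: submodule_span.
  - by split=> // YX; exact/nXv/YX.
move=> [//|[//|k]] /chain_of_lengthP[L cL]; exfalso.
have [K cK [KL nLK]] := strict_chain_pred cL.
have [K' cK' [KK' nK'K]] := strict_chain_pred cK.
have [_ XK' _] := strict_chain_in cK'; have [_ _ LY] := strict_chain_in cL.
have [sK XK KY] := strict_chain_in cK.
have [z] : exists z, K z /\ ~ X z.
  apply: contrapT => nz; apply: nK'K => z Kz; apply: XK'; apply: contrapT =>
    nXz.
  by apply: nz; exists z.
move=> [Kz nXz]; have [a Xza] := span_setU1 sX (KY _ Kz).
have Kav : K (a *: v).
  by rewrite -[_ *: _](subKr z); apply: submoduleB => //; exact: XK.
have [Xav|[b Xvb]] := simv a.
  by apply: nXz; rewrite -(subrK (a *: v) z); exact: submoduleD.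
apply: nLK; apply: subset_trans LY _; apply: span_min => // w [/XK//|->].
rewrite -(subrK (b *: (a *: v)) v); apply: submoduleD => //; first exact: XK.
exact: submoduleZ.
Qed.

Lemma rel_length1 X Y K : submodule X -> submodule Y -> rel_length X Y 1 ->
  between X Y K -> K `<=` X \/ Y `<=` K.
Proof.
move=> sX sY lXY bK; have [sK XK KY] := bK.
have [KX|nKX] := pselect (K `<=` X); first by left.
have [YK|nYK] := pselect (Y `<=` K); first by right.
suff c2 : strict_chain (between X Y) 2 Y by have := strict_chain_length c2 lXY.
have XY : X `<=` Y by exact: subset_trans KY.
have c0 : strict_chain (between X Y) 0 X by apply: strict_chain0; split.
have c1 : strict_chain (between X Y) 1 K by exact: strict_chainS c0 bK _.
by apply: strict_chainS c1 _ _; split.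
Qed.

(** In a chain of maximal length the part from [F 1] upwards has length at least [l] and [F 1] has
    length at least 1 over [X]; additivity makes both equalities. Any element of [F 1] outside [X]
    then generates [F 1] over [X]. *)
Lemma rel_lengthS X Y l : submodule X -> submodule Y -> rel_length X Y l.+1 ->
  exists v, [/\ Y v, simple_over X v &
    rel_length (submod_span (X `|` [set v])) Y l].
Proof.
move=> sX sY lXY; have [[F [bF pF]] _] := lXY.
have [sF0 XF0 F0Y] := bF 0 isT; have [sF1 XF1 F1Y] := bF 1 isT.
have [F01 nF10] := pF 0 isT.
have [i [j [lXF lFY ij]]] := rel_length_split sX sF1 sY XF1 F1Y lXY.
have lj : (l <= j)%N.
  case: lFY => _; apply; exists (fun i => F i.+1); split=> k kl; last exact: pF.
  have [sFk XFk FkY] := bF k.+1 kl; split=> //.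
  elim: k kl {sFk XFk FkY} => [_|k IH kl]; first exact: subset_refl.
  by apply: subset_trans (IH (ltnW kl)) _; case: (pF k.+1).
have i1 : (1 <= i)%N.
  apply: strict_chain_length lXF; apply: (@strict_chainS _ _ 0 X (F 1)).
  - by apply: strict_chain0; split.
  - by split.
  - by split=> // F1X; apply: nF10; exact: subset_trans XF0.
have ei : i = 1%N by lia.
have ej : j = l by lia.
rewrite {}ei {}ej in lXF lFY.
have [v] : exists v, F 1 v /\ ~ X v.
  apply: contrapT => nz; apply: nF10 => z F1z; apply: XF0; apply: contrapT =>
    nXz.
  by apply: nz; exists z.
move=> [F1v nXv].
have gen u : F 1 u -> ~ X u -> submod_span (X `|` [set u]) = F 1.
  move=> F1u nXu; set S := submod_span _.
  have SF : S `<=` F 1 by apply: span_min => // z [/XF1//|->].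
  have bS : between X (F 1) S.
    split=> //; first exact: submodule_span.
    by apply: subset_trans (@sub_span _ _ _) => z; left.
  case: (rel_length1 sX sF1 lXF bS) => [SX|FS]; last exact/seteqP.
  by case: nXu; apply: SX; apply: sub_span; right.
exists v; rewrite gen //; split=> //; first exact: F1Y.
move=> a; have [Xav|nXav] := pselect (X (a *: v)); [by left|right].
have F1av : F 1 (a *: v) by exact: submoduleZ.
by apply: (span_setU1 sX); rewrite gen.
Qed.

End Length.

(** * Exponent vectors, their lexicographic order and their number *)

Section Exponents.
Implicit Types (s t u : seq nat).

(** Used on vectors of one common size, where it is a monomial order: [ltlex_add] is the
    compatibility with multiplication of monomials. *)
Fixpoint ltlex s t : bool :=
  match s, t with
  | a :: s', b :: t' => (a < b) || (a == b) && ltlex s' t'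
  | _, _ => false
  end.

Definition add_exp s t : seq nat := [seq p.1 + p.2 | p <- zip s t].

Fixpoint exponents (d n : nat) : seq (seq nat) :=
  if d is d'.+1 then [seq a :: s | a <- iota 0 n.+1, s <- exponents d' (n - a)]
  else nseq (n == 0) [::].

Lemma exponentsS d n : exponents d.+1 n =
  [seq a :: s | a <- iota 0 n.+1, s <- exponents d (n - a)].
Proof. by []. Qed.

Lemma ltlex_irr s : ltlex s s = false.
Proof. by elim: s => //= a s ->; rewrite ltnn andbF. Qed.

Lemma ltlex_asym s t : ltlex s t -> ltlex t s = false.
Proof.
elim: s t => [|a s IH] [|b t] //= /orP[ab|/andP[/eqP-> /IH->]].
  by apply/negbTE; rewrite negb_or negb_and -leqNgt ltnW //= gtn_eqF.
by rewrite ltnn andbF.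
Qed.

Lemma ltlex_add s t u : size s = size u -> size t = size u ->
  ltlex s t -> ltlex (add_exp s u) (add_exp t u).
Proof.
elim: s t u => [|a s IH] [|b t] [|c u] //= [ss] [st].
by rewrite ltn_add2r eqn_add2r => /orP[->//|/andP[-> /IH->]] //; rewrite orbT.
Qed.

Lemma mem_exponents d n s :
  (s \in exponents d n) = (size s == d) && (sumn s == n).
Proof.
elim: d n s => [|d IH] n s.
  by case: s => [|a s]; case: n => [|n] //=; rewrite in_nil.
rewrite exponentsS; apply/allpairsPdep/idP => [[a [t [ia]]]|].
  rewrite IH => /andP[/eqP st /eqP sut] -> /=; move: ia;
    rewrite mem_iota st sut.
  lia.
case: s => [/andP[]//|a s] /andP[/eqP/= [ss] /eqP/= sus]; exists a, s;
  split=> [| |//].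
  by rewrite -[_ :: _]/(iota 0 n.+1) mem_iota; lia.
by rewrite IH ss eqxx /=; lia.
Qed.

Lemma exponents_sorted d n : pairwise ltlex (exponents d n).
Proof.
elim: d n => [|d IH] n; first by rewrite /=; case: eqP.
rewrite exponentsS.
have : pairwise ltn (iota 0 n.+1).
  by rewrite -sorted_pairwise ?iota_ltn_sorted //; exact: ltn_trans.
elim: (iota 0 n.+1) => //= a l IHl /andP[al /IHl {}IHl].
rewrite pairwise_cat IHl andbT; apply/andP; split; last first.
  rewrite pairwise_map; apply: sub_pairwise (IH (n - a)) => s t /= ->.
  by rewrite eqxx orbT.
apply/allrelP => _ _ /mapP[s _ ->] /allpairsPdep[b [t [bl _ ->]]] /=.
by have := allP al _ bl => /= ->.
Qed.

Lemma exponents_uniq d n : uniq (exponents d n).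
Proof.
rewrite uniq_pairwise; apply: sub_pairwise (exponents_sorted d n) => s t /=.
by case: eqP => // ->; rewrite ltlex_irr.
Qed.

Lemma size_add_exp s t : size s = size t -> size (add_exp s t) = size s.
Proof. by move=> e; rewrite size_map size_zip e minnn. Qed.

Lemma sumn_add_exp s t : size s = size t ->
  sumn (add_exp s t) = sumn s + sumn t.
Proof. by elim: s t => [|a s IH] [|b t] //= [/IH ->]; lia. Qed.

Lemma add_exp_inj s t u : size s = size t -> size s = size u ->
  add_exp s t = add_exp s u -> t = u.
Proof.
elim: s t u => [|a s IH] [|b t] [|c u] //= [st] [su] [/addnI-> H].
by rewrite (IH _ _ st su H).
Qed.

Lemma add_exponents d m n s t : s \in exponents d m -> t \in exponents d n ->
  add_exp s t \in exponents d (m + n).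
Proof.
rewrite !mem_exponents => /andP[/eqP ss /eqP us] /andP[/eqP st /eqP ut].
by rewrite size_add_exp ?sumn_add_exp ?ss ?st // us ut !eqxx.
Qed.

Lemma size_exponentsS d n :
  size (exponents d.+1 n) = \sum_(k < n.+1) size (exponents d k).
Proof.
transitivity (\sum_(0 <= a < n.+1) size (exponents d (n - a))).
  by rewrite exponentsS size_allpairs_dep sumnE big_map.
rewrite big_nat_rev big_mkord; apply: eq_bigr => -[k kn] _ /=.
by rewrite add0n subSS subKn.
Qed.

Lemma size_exponents d n : size (exponents d.+1 n) = 'C(n + d, d).
Proof.
elim: d n => [|d IH] n; rewrite size_exponentsS.
  by rewrite bin0 big_ord_recl /= big1.
under eq_bigr do rewrite IH.
elim: n => [|n IHn]; first by rewrite big_ord1 !binn.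
by rewrite big_ord_recr /= IHn [in RHS]addSn binS addSnnS.
Qed.

(** By Pascal's rule each of the [b] unit decrements of [n] loses one binomial ['C(k + m, m)] with k
    at most [n]. Once the truncated subtraction has reached 0 nothing more is lost. *)
Lemma binomial_drop m n b :
  'C(n + m.+1, m.+1) <= 'C(n - b + m.+1, m.+1) + b * 'C(n + m, m).
Proof.
elim: b => [|b IH]; first by rewrite subn0 leq_addr.
apply: leq_trans IH _; rewrite mulSn addnA leq_add2r subnS.
case: (n - b) (leq_subr b n) => [_|k kn] /=; first by rewrite leq_addr.
by rewrite addSn binS leq_add2l addnS -addSn leq_bin2l // leq_add2r.
Qed.

(** The multiples of [t] in degree [n] correspond to all exponents of degree [n - sumn t], and [P]
    fails on them; [binomial_drop] bounds the number of the remaining ones. *)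
Lemma count_nonmultiples d n (P : pred (seq nat)) t : size t = d.+2 ->
    (forall s, size s = d.+2 -> sumn t + sumn s = n -> ~~ P (add_exp t s)) ->
  count P (exponents d.+2 n) <= (sumn t).+1 * 'C(n + d, d).
Proof.
move=> st nP; have szN := count_predC P (exponents d.+2 n).
rewrite size_exponents in szN.
have [bn|nb] := leqP (sumn t) n; last first.
  (* Below the degree of [t] there are no multiples to discard. All monomials of degree [n] are then
     allowed, and there are at most [n.+1 * 'C(n + d, d)] of them. *)
  have := binomial_drop d n n; rewrite subnn add0n binn => Bn.
  have B0 : 0 < 'C(n + d, d) by rewrite bin_gt0 leq_addl.
  apply: leq_trans (_ : n.+1 * 'C(n + d, d) <= _);
    last by rewrite leq_mul2r ltnS ltnW ?orbT.
  by rewrite mulSn; lia.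
suff : 'C(n - sumn t + d.+1, d.+1) <= count (predC P) (exponents d.+2 n).
  have := binomial_drop d n (sumn t); rewrite mulSn; lia.
rewrite -size_exponents -(size_map (add_exp t)) -size_filter.
apply: uniq_leq_size.
  rewrite map_inj_in_uniq ?exponents_uniq // => s u.
  rewrite !mem_exponents => /andP[/eqP ss _] /andP[/eqP su _].
  by apply: add_exp_inj; rewrite st.
move=> _ /mapP[s + ->]; rewrite mem_filter !mem_exponents =>
  /andP[/eqP ss /eqP sus].
rewrite /= nP ?sus ?subnKC //=.
by rewrite size_add_exp ?sumn_add_exp ?st ?ss // sus subnKC ?eqxx.
Qed.

End Exponents.

(** * Monomials in a sequence of ring elements *)

Section Monomials.
Local Open Scope ring_scope.
Import GRing.Theory.
Context {A : comNzRingType}.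

Fixpoint monomial (x : seq A) (s : seq nat) : A :=
  match x, s with
  | a :: x', k :: s' => a ^+ k * monomial x' s'
  | _, _ => 1
  end.

Lemma monomial_add x s t : size s = size x -> size t = size x ->
  monomial x (add_exp s t) = monomial x s * monomial x t.
Proof.
elim: x s t => [|a x IH] [|k s] [|l t] //= => [_ _|[ss] [st]].
  by rewrite mulr1.
by rewrite IH // exprD mulrACA.
Qed.

Lemma monomial0 x s : sumn s = 0 -> monomial x s = 1.
Proof.
elim: x s => [|a x IH] [|k s] //= /eqP; rewrite addn_eq0 => /andP[/eqP-> /eqP].
by move=> /IH ->; rewrite mulr1.
Qed.

End Monomials.

(** * Lengths of graded pieces over a polynomial ring *)

Section Growth.
Local Open Scope ring_scope.
Import GRing.Theory.
Context {A : comNzRingType} {V : lmodType A}.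
Implicit Types (W N : set V) (Y : nat -> set V).

(** What has been built when the [w t] are added to [W] in increasing order and the turn of [w s]
    comes. The [s] with [w s] outside it are the standard monomials of Gröbner basis theory. *)
Definition lower_span W (w : seq nat -> V) (r : seq (seq nat)) s : set V :=
  submod_span (W `|` [set w t | t in [set t | t \in r /\ ltlex t s]]).

Lemma rel_length_span_seq W (w : seq nat -> V) r : submodule W ->
    pairwise ltlex r -> (forall s, s \in r -> simple_over W (w s)) ->
  rel_length W (submod_span (W `|` [set w s | s in [set` r]]))
    (count (fun s => w s \notin lower_span W w r s) r).
Proof.
move=> sW; elim/last_ind: r => [|r s IH].
  move=> _ _ /=; rewrite (_ : submod_span _ = W); first exact: rel_length_refl.
  apply: span_eq => // [z [//|[s /=]]|K _ WK z Wz]; first by rewrite in_nil.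
  by apply: WK; left.
rewrite -cats1 pairwise_cat allrel1r => /and3P[/allP rs prs _] simw.
pose S := submod_span (W `|` [set w s | s in [set` r]]).
have sS : submodule S by exact: submodule_span.
have WS : W `<=` S.
  by apply: subset_trans (@sub_span _ _ _) => z; left.
have lr t : t \in r -> lower_span W w (r ++ [:: s]) t = lower_span W w r t.
  move=> tr; congr submod_span; congr setU; congr image; apply/seteqP.
  split=> u /= [ur ut]; split=> //; last by rewrite mem_cat ur.
  move: ur ut; rewrite mem_cat inE => /orP[//|/eqP ->].
  by rewrite (ltlex_asym (rs _ tr)).
have ls : lower_span W w (r ++ [:: s]) s = S.
  congr submod_span; congr setU; congr image; apply/seteqP.
  split=> u /= => [[]|ur]; last by split; [rewrite mem_cat ur|exact: rs].
  by rewrite mem_cat inE => /orP[//|/eqP ->]; rewrite ltlex_irr.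
have -> : submod_span (W `|` [set w s0 | s0 in [set` r ++ [:: s]]]) =
    submod_span (S `|` [set w s]).
  apply: span_eq; last 2 first.
  - exact: submodule_span.
  - move=> K sK WK; apply: span_min => // z [Sz|->].
      move: z Sz.
      apply: span_min => // {}z [Wz|[t /= tr <-]]; apply: WK; [by left|right].
      by exists t => //=; rewrite mem_cat tr.
    by apply: WK; right; exists s => //=; rewrite mem_cat inE eqxx orbT.
  move=> z [/WS Sz|[t /= + <-]]; first by apply: sub_span; left.
  rewrite mem_cat inE => /orP[tr|/eqP->]; apply: sub_span; [left|by right].
  by apply: sub_span; right; exists t.
have SS : S `<=` submod_span (S `|` [set w s]).
  by apply: subset_trans (@sub_span _ _ _) => z; left.
rewrite count_cat /= addn0 ls.
apply: (rel_length_add _ _ WS SS) => //; first exact: submodule_span.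
  rewrite (eq_in_count (a2 := fun t => w t \notin lower_span W w r t)).
    by apply: IH => // t tr; apply: simw; rewrite mem_cat tr.
  by move=> t /lr ->.
apply: rel_length_simple => //; apply: simple_over_le WS _.
by apply: simw; rewrite mem_cat inE eqxx orbT.
Qed.


Definition monomial_closed (x : seq A) Y : Prop :=
  forall k n s y, s \in exponents (size x) k -> Y n y ->
    Y (k + n)%N (monomial x s *: y).

Definition spread (x : seq A) Y N (n : nat) : set V :=
  submod_span (Y n `|`
    [set monomial x s *: y | s in [set` exponents (size x) n] & y in N]).

(* Lengths of the graded pieces of a standard graded module over a polynomial
   ring in [d + 2] variables; a copy of the polynomial ring accounts for
   ['C(n + d + 1, d + 1)], and a proper cyclic quotient of it is
   asymptotically smaller. *)
Definition growth_bounds (d : nat) (X Z : nat -> set V) (a K : nat) : Prop :=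
  forall n, exists l, [/\ rel_length (X n) (Z n) l,
    (a * 'C(n + d.+1, d.+1) <= l)%N &
    (l <= a * 'C(n + d.+1, d.+1) + K * 'C(n + d, d))%N].

(** The length in degree [n] is the number of standard monomials. If one monomial is not standard,
    no multiple of it is, because the order is compatible with products, and the count drops to the
    order of ['C(n + d, d)]; otherwise every monomial counts. *)
Lemma growth_simple (x : seq A) d Y v : size x = d.+2 ->
    (forall n, submodule (Y n)) -> monomial_closed x Y ->
    simple_over (Y 0) v ->
  exists a K, (a <= 1)%N /\ growth_bounds d Y (spread x Y [set v]) a K.
Proof.
move=> sx sY cY simv; pose w s := monomial x s *: v.
pose L n := lower_span (Y n) w (exponents (size x) n).
have len n : rel_length (Y n) (spread x Y [set v] n)
    (count (fun s => w s \notin L n s) (exponents (size x) n)).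
  rewrite /spread.
  rewrite (_ : [set monomial x s *: y | s in _ & y in _] =
      [set w s | s in [set` exponents (size x) n]]); last first.
    apply/seteqP; split=> [_ [s sn [_ -> <-]]|_ [s sn <-]]; first by exists s.
    by exists s => //; exists v.
  apply: rel_length_span_seq => //; first exact: exponents_sorted.
  move=> s sn a; case: (simv a) => [Yav|[b Yvb]]; [left|right].
    by rewrite /w scalerA mulrC -scalerA -(addn0 n); exact: cY.
  exists b; rewrite /w (scalerA a) (mulrC a) -scalerA scalerA (mulrC b) -scalerA.
  by rewrite -scalerBr -(addn0 n); exact: cY.
have [[n0 [t [tn0 Lt]]]|nL] := pselect (exists n t,
  t \in exponents (size x) n /\ L n t (w t)).
  exists 0%N, (sumn t).+1; split=> // n; eexists; split; [exact: len|by []|].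
  move: (tn0); rewrite mem_exponents => /andP[/eqP st /eqP ut].
  rewrite mul0n add0n sx; apply: count_nonmultiples; first by rewrite st.
  move=> s ss us; rewrite negbK; apply/mem_set.
  have sk : s \in exponents (size x) (sumn s) by rewrite mem_exponents ss sx !eqxx.
  have sL : submodule (L n (add_exp t s)) by exact: submodule_span.
  have en : (sumn s + n0)%N = n by rewrite -us ut addnC.
  rewrite /w monomial_add ?ss ?st // mulrC -scalerA.
  suff: L n0 t `<=` [set z | L n (add_exp t s) (monomial x s *: z)] by apply.
  apply: span_min; first exact: submodule_preZ.
  move=> z [Yz|[u /= [un ut'] <-]]; apply: sub_span.
    by left; rewrite -en; exact: cY.
  move: (un); rewrite mem_exponents => /andP[/eqP su /eqP uu].
  right; exists (add_exp u s); first split.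
  - by rewrite -en addnC; exact: add_exponents.
  - by apply: ltlex_add; rewrite ?su ?st ?ss.
  - by rewrite /w monomial_add ?ss // mulrC scalerA.
exists 1%N, 0%N; split=> // n; eexists; split; first exact: len.
  rewrite mul1n -size_exponents -sx -[X in (X <= _)%N]count_predT.
  apply: eq_leq; apply: eq_in_count => s sn; symmetry.
  by apply/negP => /set_mem Ls; apply: nL; exists n, s.
by rewrite mul1n mul0n addn0 -size_exponents -sx count_size.
Qed.

(** Induction on the length of [N] over [Y 0]: a simple generator [v] is absorbed into [Y], giving
    the again monomial-closed family [Y'] with [Y' 0] one step higher. Each step adds at most 1 to
    [a]; [K] is not bounded in terms of [l]. *)
Lemma growth (x : seq A) d Y N l : size x = d.+2 ->
    (forall n, submodule (Y n)) -> monomial_closed x Y ->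
    submodule N -> Y 0 `<=` N -> rel_length (Y 0) N l ->
  exists a K, (a <= l)%N /\ growth_bounds d Y (spread x Y N) a K.
Proof.
move=> sx + + sN; elim: l Y => [|l IH] Y sY cY YN lYN.
  have NY : N `<=` Y 0.
    apply: contrapT => nNY; have c0 : strict_chain (between (Y 0) N) 0 (Y 0).
      by apply: strict_chain0; split.
    have c1 : strict_chain (between (Y 0) N) 1 N by apply: strict_chainS c0 _ _; split.
    by have := strict_chain_length c1 lYN.
  exists 0%N, 0%N; split=> // n; exists 0%N; split=> //.
  rewrite (_ : spread x Y N n = Y n); first exact: rel_length_refl.
  apply: span_eq => // [z [//|[s sn [y /NY Yy <-]]]|K _ YK z Yz].
    by rewrite -(addn0 n); exact: cY.
  by apply: YK; left.
have [v [Nv simv lvN]] := rel_lengthS (sY 0%N) sN lYN.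
pose Y' := spread x Y [set v].
have sY' n : submodule (Y' n) by exact: submodule_span.
have YY' n : Y n `<=` Y' n by apply: subset_trans (@sub_span _ _ _) => z; left.
have Y'0 : Y' 0%N = submod_span (Y 0 `|` [set v]).
  apply/seteqP; split; apply: span_min; try exact: submodule_span.
    move=> z [Yz|[s s0 [_ -> <-]]]; apply: sub_span; [by left|right].
    move: s0; rewrite /= mem_exponents => /andP[_ /eqP s0].
    by rewrite monomial0 // scale1r.
  move=> z [Yz|->]; apply: sub_span; [by left|right].
  exists (nseq (size x) 0%N); first by rewrite /= mem_exponents size_nseq sumn_nseq mul0n !eqxx.
  by exists v => //; rewrite monomial0 ?scale1r // sumn_nseq.
have cY' : monomial_closed x Y'.
  move=> k n s y sk; suff: Y' n `<=` [set y |
    Y' (k + n)%N (monomial x s *: y)] by apply.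
  apply: span_min; first exact: submodule_preZ.
  move=> {}y [Yy|[t /= tn [_ -> <-]]]; apply: sub_span; [left; exact: cY|right].
  exists (add_exp s t); first exact: add_exponents.
  move: sk tn; rewrite !mem_exponents => /andP[/eqP ss _] /andP[/eqP st _].
  by exists v; rewrite ?monomial_add ?scalerA.
have Y'N : Y' 0%N `<=` N by rewrite Y'0; apply: span_min => // z [/YN//|->].
have [|a' [K' [a'l bY']]] := IH Y' sY' cY' Y'N; first by rewrite Y'0.
have [a [K [a1 bY]]] := growth_simple sx sY cY simv.
exists (a + a')%N, (K + K')%N; split; first by rewrite -add1n leq_add.
move=> n; have [i [li ai iK]] := bY n; have [j [lj aj jK]] := bY' n.
exists (i + j)%N; split; last 2 first.
- by rewrite mulnDl leq_add.
- by rewrite !mulnDl addnACA leq_add.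
have -> : spread x Y N n = spread x Y' N n.
  apply/seteqP; split; apply: span_min; try exact: submodule_span.
    by move=> z [/YY' Yz|Nz]; apply: sub_span; [left|right].
  move=> z [Yz|Nz]; last by apply: sub_span; right.
  move: z Yz; apply: span_le => z [Yz|[s sn [_ -> <-]]]; [by left|right].
  by exists s => //; exists v.
apply: (rel_length_add _ _ (YY' n) _ li lj); try exact: submodule_span.
by apply: subset_trans (@sub_span _ _ _) => z; left.
Qed.

End Growth.

(** * Polynomials in the binomial basis and their coefficients *)

Section BinomialSums.
Local Open Scope ring_scope.
Import Order.TTheory GRing.Theory Num.Theory.
Implicit Types (u w : nat -> int) (s n d : nat).

(** A Hilbert polynomial, with the alternating signs absorbed into [u]. *)
Definition binomial_sum u s n : int :=
  \sum_(i < s.+1) u i * ('C(n + s - i, s - i))%:Z.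

Lemma binomial_sumS u s n : binomial_sum u s.+1 n =
  u 0%N * ('C(n + s.+1, s.+1))%:Z + binomial_sum (u \o S) s n.
Proof.
rewrite /binomial_sum big_ord_recl /= !subn0; congr (_ + _).
by apply: eq_bigr => i _ /=; rewrite /bump /= add1n addnS !subSS.
Qed.

Lemma binomial_sumD u w s n :
  binomial_sum (fun i => u i + w i) s n = binomial_sum u s n + binomial_sum w s n.
Proof. by rewrite -big_split; apply: eq_bigr => i _; rewrite mulrDl. Qed.

Lemma binomial_sumZ a u s n :
  binomial_sum (fun i => a * u i) s n = a * binomial_sum u s n.
Proof. by rewrite mulr_sumr; apply: eq_bigr => i _; rewrite mulrA. Qed.

Lemma binomial_sum_const a s n :
  binomial_sum (fun=> a) s n = a * ('C(n.+1 + s, s))%:Z.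
Proof.
elim: s => [|s IH]; first by rewrite /binomial_sum big_ord1 !bin0.
rewrite binomial_sumS IH -mulrDr; congr (_ * _).
by rewrite [in RHS]addSn binS PoszD addSnnS.
Qed.

(** Pascal's rule spreads each binomial over itself and all those of lower degree, so shifting the
    argument by 1 replaces coefficients by their partial sums. Iterating [r] times produces the
    ['C(r.+1, 2)] of the next lemma. *)
Lemma binomial_sum_succ u s n :
  binomial_sum u s n.+1 = binomial_sum (fun i => \sum_(j < i.+1) u j) s n.
Proof.
elim: s u => [|s IH] u; first by rewrite /binomial_sum !big_ord1 !bin0.
rewrite !binomial_sumS IH [in LHS]addSn binS PoszD big_ord1.
rewrite mulrDr -addrA; congr (_ + _).
rewrite -addSnnS -binomial_sum_const -binomial_sumD.
apply: eq_bigr => i _; congr (_ * _).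
by rewrite [in RHS]/= [in RHS]big_ord_recl.
Qed.

Lemma binomial_sum_shift u s r : exists w,
  [/\ forall n, binomial_sum u s (n + r) = binomial_sum w s n,
      w 0%N = u 0%N, w 1%N = u 1%N + r%:Z * u 0%N &
      w 2%N = u 2%N + r%:Z * u 1%N + ('C(r.+1, 2))%:Z * u 0%N].
Proof.
elim: r => [|r [w [wn w0 w1 w2]]].
  exists u; split=> [n|//||]; first by rewrite addn0.
    by rewrite mul0r addr0.
  by rewrite bin_small // !mul0r !addr0.
exists (fun i => \sum_(j < i.+1) w j); split.
- by move=> n; rewrite addnS -addSn wn binomial_sum_succ.
- by rewrite big_ord1.
- by rewrite !big_ord_recr big_ord0 /= w0 w1 intS; ring.
- rewrite !big_ord_recr big_ord0 /= w0 w1 w2 [in RHS]binS bin1 PoszD !intS;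
  ring.
Qed.

Lemma binomial_sum_le u s n :
  binomial_sum u s n <= (\sum_(i < s.+1) `|u i|) * ('C(n + s, s))%:Z.
Proof.
rewrite mulr_suml; apply: ler_sum => i _.
apply: (le_trans (ler_wpM2r _ (ler_norm _))) => //.
have is_ : (i <= s)%N by rewrite -ltnS.
apply: ler_wpM2l => //; rewrite lez_nat -addnBA //.
rewrite -[leqLHS]bin_sub ?leq_addl // -[leqRHS]bin_sub ?leq_addl // !addnK.
by apply: leq_bin2l; rewrite leq_add2l leq_subr.
Qed.

Lemma binomial_sum_lead w s n0 :
  (forall n, (n0 <= n)%N -> 0 <= binomial_sum w s n) -> 0 <= w 0%N.
Proof.
case: s => [|s] wn.
  by have := wn n0 (leqnn _); rewrite /binomial_sum big_ord1 !bin0 mulr1.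
rewrite leNgt; apply/negP => w0.
pose T := \sum_(i < s.+1) `|(w \o S) i|.
have T0 : 0 <= T by apply: sumr_ge0.
(* Large enough for the leading binomial to exceed [T] times ['C(n + s, s)]: by [mul_bin_diag] their
   ratio is [(n + s.+1) / s.+1]. A negative leading coefficient would then outweigh the tail. *)
pose n := (n0 + s.+1 * `|T|)%N.
have := wn n (leq_addr _ _); apply/negP; rewrite -ltNge binomial_sumS.
have := binomial_sum_le (w \o S) s n; rewrite -/T => tail.
have B0 : (0 < 'C(n + s, s))%N by rewrite bin_gt0 leq_addl.
have := mul_bin_diag (n + s.+1) s; rewrite addnS /= => diag.
have : (s.+1 * `|T| < (n + s).+1)%N by rewrite /n; lia.
clearbody n; clearbody T; case: T T0 tail => // T _ tail sT.
move: tail B0 diag sT; set b := 'C(n + s, s); set c := 'C(_, s.+1).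
set t := binomial_sum _ _ _; rewrite absz_nat => tail b0 diag sT.
have st : s.+1%:Z * t <= s.+1%:Z * (T%:Z * b%:Z) by rewrite ler_pM2l.
have wc : s.+1%:Z * (w 0%N * c%:Z) <= - (s.+1%:Z * c%:Z) by nia.
have Tb : (s.+1 * T * b < (n + s).+1 * b)%N by rewrite ltn_pmul2r.
rewrite -(@pmulr_rlt0 _ s.+1%:Z) // mulrDr; lia.
Qed.

Lemma binomial_sum_squeeze w d n0 K :
    (forall n, (n0 <= n)%N ->
      0 <= binomial_sum w d.+2 n <= K * ('C(n + d, d))%:Z) ->
  [/\ w 0%N = 0, w 1%N = 0 & 0 <= w 2%N].
Proof.
move=> wn.
have low0 n : (n0 <= n)%N -> 0 <= binomial_sum w d.+2 n by case/wn/andP.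
(* The coefficients of the upper bound minus the sum: ['C(n + d, d)] is the basis element of index
   2. Applying [binomial_sum_lead] to both [w] and [k] kills the first two coefficients. *)
pose k i := (i == 2%N)%:R * K - w i.
have kE n : binomial_sum k d.+2 n = K * ('C(n + d,
  d))%:Z - binomial_sum w d.+2 n.
  have -> : binomial_sum k d.+2 n =
      binomial_sum (fun i => (i == 2%N)%:R * K + -1 * w i) d.+2 n.
    by apply: eq_bigr => i _; rewrite mulN1r.
  rewrite binomial_sumD binomial_sumZ mulN1r; congr (_ - _).
  rewrite !binomial_sumS /= !mul0r !add0r.
  case: d {wn low0} => [|d]; first by rewrite /binomial_sum big_ord1 /= !bin0 mul1r.
  rewrite binomial_sumS /= mul1r -[RHS]addr0; congr (_ + _).
  by rewrite /binomial_sum big1 // => i _; rewrite /= !mul0r.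
have up0 n : (n0 <= n)%N -> 0 <= binomial_sum k d.+2 n.
  by case/wn/andP => _; rewrite kE subr_ge0.
have w0 : w 0%N = 0.
  have := binomial_sum_lead low0; have := binomial_sum_lead up0.
  by rewrite /k mul0r add0r => ? ?; lia.
have low1 n : (n0 <= n)%N -> 0 <= binomial_sum (w \o S) d.+1 n.
  by move=> /low0; rewrite binomial_sumS w0 mul0r add0r.
have up1 n : (n0 <= n)%N -> 0 <= binomial_sum (k \o S) d.+1 n.
  by move=> /up0; rewrite binomial_sumS {1}/k w0 mul0r subr0 mul0r add0r.
have w1 : w 1%N = 0.
  have := binomial_sum_lead low1; have := binomial_sum_lead up1.
  by rewrite /= /k mul0r add0r => ? ?; lia.
split=> //; apply: (@binomial_sum_lead (w \o S \o S) d n0) => n /low1.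
by rewrite binomial_sumS /= w1 mul0r add0r.
Qed.

Lemma binomial_sum_compare u w d r c K n0 :
    (forall n, (n0 <= n)%N -> exists l : nat,
      [/\ binomial_sum u d.+2 (n + r) = binomial_sum w d.+2 n + l%:Z,
         (c * 'C(n + d.+1, d.+1) <= l)%N &
         (l <= c * 'C(n + d.+1, d.+1) + K * 'C(n + d, d))%N]) ->
  [/\ u 0%N = w 0%N, u 1%N + r%:Z * u 0%N = w 1%N + c%:Z &
     w 2%N <= u 2%N + r%:Z * u 1%N + ('C(r.+1, 2))%:Z * u 0%N].
Proof.
move=> H; have [v [vE /esym v0 v1 v2]] := binomial_sum_shift u d.+2 r.
(* The coefficients of the error term, that is, of [l] minus its main part; ['C(n + d.+1, d.+1)] is
   the basis element of index 1. *)
pose z i := v i + -1 * (w i + c%:Z * (i == 1%N)%:R).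
have zE n : binomial_sum z d.+2 n =
    binomial_sum v d.+2 n - (binomial_sum w d.+2 n + c%:Z * ('C(n + d.+1,
      d.+1))%:Z).
  rewrite binomial_sumD binomial_sumZ binomial_sumD binomial_sumZ mulN1r.
  congr (_ - (_ + _ * _)); rewrite !binomial_sumS /= mul0r add0r mul1r.
  rewrite -[RHS]addr0; congr (_ + _).
  by rewrite /binomial_sum big1 // => i _; rewrite /= mul0r.
have [|z0 z1 z2] := @binomial_sum_squeeze z d n0 K%:Z.
  move=> n /H[l [ul cl lK]]; rewrite zE -vE ul.
  by lia.
rewrite -v2 -v1 v0; move: z0 z1 z2; rewrite /z /= !mulr0 mulr1 !addr0 !mulN1r.
by move=> /subr0_eq ? /subr0_eq ?; rewrite subr_ge0.
Qed.

End BinomialSums.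

(** * Ascending chains and Hilbert's basis theorem *)

Section HilbertBasis.
Local Open Scope ring_scope.
Import GRing.Theory.

Lemma noetherian_union (R : comNzRingType) (b : nat -> set R) :
    noetherian R -> (forall n, ideal (b n)) -> (forall n, b n `<=` b n.+1) ->
  exists N, forall n, b n `<=` b N.
Proof.
move=> nR ib bS.
have ble m n : (m <= n)%N -> b m `<=` b n.
  move=> /subnK <-; elim: (n - m)%N => [|k IH]; first exact: subset_refl.
  exact: subset_trans IH (bS _).
pose U := \bigcup_n b n.
have iU : ideal U.
  apply/submoduleP; split; first by exists 0%N => //;
    exact: submodule0 (ib 0%N).
  move=> a u v [m _ bu] [n _ bv]; exists (m + n)%N => //.
  apply: (submoduleD (ib _)); last exact: ble (leq_addl _ _) _ bv.
  by apply: (submoduleZ _ (ib _)); exact: ble (leq_addr _ _) _ bu.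
have [s Us] := nR U iU.
have [N sN] : exists N, [set` s] `<=` b N.
  have : [set` s] `<=` U by rewrite Us; exact: sub_span.
  elim: s {Us} => [|a s IH] sU; first by exists 0%N.
  have [|N sN] := IH; first by move=> z /= zs; apply: sU;
    rewrite /= inE zs orbT.
  have [|M _ aM] := sU a; first by rewrite /= inE eqxx.
  exists (M + N)%N => z /=; rewrite inE => /orP[/eqP->|/sN bz].
    exact: ble (leq_addr _ _) _ aM.
  exact: ble (leq_addl _ _) _ bz.
exists N => n; apply: (@subset_trans _ U); first by move=> z bz; exists n.
by rewrite Us; exact: span_min (ib N) sN.
Qed.

(** The ideals [lead n] of coefficients in degree [n] become stationary at some [N]. Polynomials
    realising generators of [lead n] for [n] up to [N] generate [P], by cancelling top coefficients;
    above degree [N] they are multiplied by a power of the variable. *)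
Lemma noetherian_poly (R : comNzRingType) : noetherian R -> noetherian {poly R}.
Proof.
move=> nR P iP.
pose lead n : set R := [set a | exists p : {poly R}, [/\ P p,
  (size p <= n.+1)%N & p`_n = a]].
have ilead n : ideal (lead n).
  apply/submoduleP; split.
    by exists 0; split; [exact: (submodule0 iP)|rewrite size_poly0|rewrite coef0].
  move=> a _ _ [p [Pp sp <-]] [q [Pq sq <-]]; exists (a%:P * p + q); split.
  - by apply: (submoduleD iP) => //; exact: (submoduleZ _ iP).
  - apply: leq_trans (size_polyD _ _) _; rewrite geq_max sq andbT mul_polyC.
    exact: leq_trans (size_scale_leq _ _) sp.
  - by rewrite coefD coefCM.
have leadS n : lead n `<=` lead n.+1.
  move=> _ [p [Pp sp <-]]; exists ('X * p); split.
  - exact: (submoduleZ _ iP).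
  - by apply: leq_trans (size_polyMleq _ _) _; rewrite size_polyX.
  - by rewrite coefXM.
have [N leadN] := noetherian_union nR ilead leadS.
have step n : exists S : seq {poly R}, [set` S] `<=` P /\ forall a, lead n a ->
    exists q, [/\ submod_span ([set` S] : set {poly R}^o) q,
      (size q <= n.+1)%N & q`_n = a].
  have [s es] := nR _ (ilead n).
  have /choice[F FP] a : exists p : {poly R}, lead n a ->
      [/\ P p, (size p <= n.+1)%N & p`_n = a].
    have [[p Hp]|na] := pselect (lead n a); last by exists 0.
    by exists p.
  have sl : [set` s] `<=` lead n by rewrite es; exact: sub_span.
  exists (map F s); split=> [p /= /mapP[a sa ->]|a];
    first by case: (FP a (sl _ sa)).
  rewrite es => /spanP[c ->]; exists (\sum_(i < size s) (c i)%:P * F s`_i);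
    split.
  - apply: submodule_sum (submodule_span _) _ => i;
    apply: (submoduleZ _ (submodule_span _)).
    by apply: sub_span; rewrite /= map_f // mem_nth.
  - apply: leq_trans (size_sum _ _ _) _; apply/bigmax_leqP => i _.
    rewrite mul_polyC; apply: leq_trans (size_scale_leq _ _) _.
    by case: (FP s`_i (sl _ (mem_nth _ _))).
  - rewrite coef_sum; apply: eq_bigr => i _; rewrite coefCM.
    by case: (FP s`_i (sl _ (mem_nth _ _))) => // _ _ ->.
have [G GP] := choice step.
pose S := flatten (mkseq G N.+1).
have sS n : (n <= N)%N -> [set` G n] `<=` [set` S].
  move=> nN p /= pG; apply/flattenP; exists (G n) => //; apply/mapP.
  by exists n; rewrite // mem_iota.
have lift n a : lead n a ->
    exists q, [/\ submod_span ([set` S] : set {poly R}^o) q,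
      (size q <= n.+1)%N & q`_n = a].
  have [nN|Nn] := leqP n N.
    case/(GP n).2 => q [Gq sq qa]; exists q; split=> //.
    by apply: span_le Gq; exact: sS.
  case/leadN/(GP N).2 => q [Gq sq qa]; exists ('X^(n - N) * q); split.
  - by apply: (submoduleZ _ (submodule_span _)); apply: span_le Gq; exact: sS.
  - by apply: leq_trans (size_polyMleq _ _) _; rewrite size_polyXn; lia.
  - by rewrite coefXnM ltnNge leq_subr /= subKn // ltnW.
exists S; apply/seteqP; split; last first.
  apply: span_min => // p /= /flattenP[_ /mapP[n _ ->]]; exact: (GP n).1.
move=> p; have [n] := ubnP (size p); elim: n p => // n IH p; rewrite ltnS =>
  sp Pp.
case: n IH sp => [|n] IH sp.
  move: sp; rewrite leqn0 size_poly_eq0 => /eqP ->;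
    exact: (submodule0 (submodule_span _)).
have [|q [Sq sq qn]] := @lift n p`_n; first by exists p.
have Pq : P q.
  by move: q Sq {sq qn}; apply: span_min =>
    // r /= /flattenP[_ /mapP[k _ ->]]; exact: (GP k).1.
rewrite -(subrK q p); apply: (submoduleD (submodule_span _)) => //; apply: IH.
  rewrite ltnS; apply/leq_sizeP => j; rewrite leq_eqVlt => /orP[/eqP<-|nj].
    by rewrite coefB qn subrr.
  by rewrite coefB !nth_default ?subr0 //;
    [exact: leq_trans sq _|exact: leq_trans sp _].
exact: (submoduleB iP).
Qed.

(** All that is retained of the polynomial ring in [m] variables is Noetherianity and evaluation at
    every point; the ring is obtained by adjoining one variable at a time. *)
Lemma noetherian_indeterminates (A : comNzRingType) m : noetherian A ->
  exists (B : comNzRingType) (iota : {rmorphism A -> B}) (T : nat -> B),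
    noetherian B /\ forall t : nat -> A, exists ev : {rmorphism B -> A},
      (forall a, ev (iota a) = a) /\ forall i, (i < m)%N -> ev (T i) = t i.
Proof.
move=> nA; elim: m => [|m [B [iota [T [nB BT]]]]].
  by exists A, idfun, (fun=> 0); split=> // t; exists idfun.
exists {poly B}, (polyC \o iota), (fun i => if (i < m)%N then (T i)%:P else 'X).
split; first exact: noetherian_poly.
move=> t; have [ev [evi evT]] := BT t.
have cu : commr_rmorph ev (t m) by move=> ?; exact: mulrC.
exists (horner_morph cu); split=> [a|i im] /=.
  by rewrite horner_morphC evi.
case: ltnP => [im'|mi]; first by rewrite horner_morphC evT.
by rewrite horner_morphX; congr t; lia.
Qed.

End HilbertBasis.

(** * One reduction exponent for all reductions *)

Section Reductions.
Local Open Scope ring_scope.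
Import GRing.Theory.

(** Generators are eliminated one by one, multiplying the factors [1 - c] that arise. The resulting
    [g] takes the place of the determinant in the usual argument. *)
Lemma nakayama (B : comNzRingType) (V : lmodType B) (I : set B) (W : set V)
    (s : seq V) : ideal I -> submodule W ->
    (forall y, y \in s ->
      submod_span (W `|` [set c *: z | c in I & z in [set` s]]) y) ->
  exists2 g, I (1 - g) & forall y, y \in s -> W (g *: y).
Proof.
move=> iI sW; elim: s => [|y s IH] sy.
  by exists 1 => //; rewrite subrr; exact: (submodule0 iI).
pose E := submod_span (W `|` [set c *: z | c in I & z in [set` s]]).
have sE : submodule E by exact: submodule_span.
have elim_y z : z \in y :: s -> exists2 c, I c & E (z - c *: y).
  pose F := [set z | exists2 c, I c & E (z - c *: y)].
  move=> /sy yz; suff sF : submodule F.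
    suff: F z by []; move: z yz; apply: span_min =>
      // z [Wz|[c Ic [u /= + <-]]].
      exists 0; first exact: (submodule0 iI).
      by rewrite scale0r subr0; apply: sub_span; left.
    rewrite inE => /predU1P[->|us].
      by exists c => //; rewrite subrr; exact: (submodule0 sE).
    exists 0; first exact: (submodule0 iI).
    by rewrite scale0r subr0; apply: sub_span; right; exists c => //; exists u.
  apply/submoduleP; split.
    exists 0; first exact: (submodule0 iI).
    by rewrite scale0r subr0; exact: (submodule0 sE).
  move=> a u v [c Ic Eu] [c' Ic' Ev]; exists (a * c + c').
    apply: (submoduleD iI) => //; exact: (submoduleZ _ iI).
  rewrite scalerDl -scalerA opprD addrACA -scalerBr.
  by apply: (submoduleD sE) => //; exact: (submoduleZ _ sE).
have [c Ic Ey] := elim_y y (mem_head _ _).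
have {}Ey : E ((1 - c) *: y) by rewrite scalerBl scale1r.
have [|g Ig gW] := IH.
  move=> z zs; have [|c' Ic' Ez] := elim_y z; first by rewrite inE zs orbT.
  (* This removes [y] from the relation for [z]: the first two terms lie in [E], and the last is a
     coefficient from [I] times a remaining generator. *)
  suff -> : z = (1 - c) *: (z - c' *: y) + c' *: ((1 - c) *: y) + c *: z.
    apply: (submoduleD sE).
      by apply: (submoduleD sE); exact: (submoduleZ _ sE).
    by apply: sub_span; right; exists c => //; exists z.
  rewrite scalerBr !scalerA [c' * _]mulrC subrK -scalerDl subrK.
  by rewrite scale1r.
have gE : E `<=` [set z | W (g *: z)].
  apply: span_min; first exact: submodule_preZ.
  move=> z [Wz|[a Ia [u /gW Wu <-]]] /=; first exact: (submoduleZ _ sW).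
  by rewrite scalerA mulrC -scalerA; exact: (submoduleZ _ sW).
exists (g * (1 - c)).
  rewrite mulrBr mulr1 opprB addrA addrAC.
  by apply: (submoduleD iI) => //; exact: (submoduleZ _ iI).
move=> z; rewrite inE => /predU1P[->|/gW Wz].
  by rewrite -scalerA; exact: gE.
by rewrite mulrC -scalerA; exact: (submoduleZ _ sW).
Qed.

Definition reduction_at (A : comNzRingType) (J q : set A) (n : nat) : Prop :=
  ideal_pow J n.+1 `<=` smul q (ideal_pow J n : set A^o).

Lemma ideal_ideal_pow (A : comNzRingType) (J : set A) n : ideal (ideal_pow J n).
Proof. by case: n => [|n]; [exact: submoduleT|exact: submodule_smul]. Qed.

(* Whether [q] is a reduction of [J] depends on the coefficients of the
   generators of [q] through the non-vanishing modulo maximal ideals of the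
   ideals [b n] of a polynomial ring; these stabilise. *)
Lemma uniform_reduction (A : comNzRingType) (f : seq A) d : noetherian A ->
  exists r, forall x : seq A, size x = d -> [set` x] `<=` ideal_gen [set` f] ->
    (exists n, reduction_at (ideal_gen [set` f]) (ideal_gen [set` x]) n) ->
    reduction_at (ideal_gen [set` f]) (ideal_gen [set` x]) r.
Proof.
move=> nA; set J := ideal_gen _; pose N := size f; pose K := ideal_pow J.
have [B [iota [T [nB BT]]]] := noetherian_indeterminates (d * N) nA.
(* Generic combinations of the generators of [J]: the coefficient of the [j]-th generator in the
   [i]-th form is the variable numbered [i * N + j]. Below, [R n] is the generic q J^n and [b n] the
   ideal of multipliers of J^(n+1) into it. *)
pose L i := \sum_(j < N) T (i * N + j)%N * iota f`_j.
pose R n : set B := ideal_gen [set b | exists i z, [/\ (i < d)%N, K n z &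
  b = L i * iota z]].
have iR n : ideal (R n) by exact: submodule_span.
pose b n : set B := [set g | forall y, K n.+1 y -> R n (g * iota y)].
have ib n : ideal (b n).
  apply/submoduleP; split=> [y _|a u v bu bv y Ky]; first by rewrite mul0r;
    exact: (submodule0 (iR n)).
  rewrite mulrDl -[a *: u]/(a * u) -mulrA; apply: (submoduleD (iR n));
    last exact: bv.
  by apply: (submoduleZ a (iR n)); exact: bu.
have bS n : b n `<=` b n.+1.
  move=> g bg; suff : K n.+2 `<=` [set y : A^o | R n.+1 (g * iota y)] by [].
  have sRg : submodule [set y : A^o | R n.+1 (g * iota y)].
    apply/submoduleP; split=> [|a u v /= Ru Rv].
      by rewrite /= rmorph0 mulr0; exact: (submodule0 (iR _)).
    rewrite rmorphD -[a *: u]/(a * u) rmorphM mulrDr mulrCA.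
    by apply: (submoduleD (iR _)) => //; exact: (submoduleZ _ (iR _)).
  apply: smul_min sRg _ => a y Ja /bg Rgy.
  suff: R n `<=` [set z : B^o | R n.+1 (iota a * z)].
    by move=> /(_ _ Rgy) /=; rewrite -[a *: y]/(a * y) rmorphM mulrCA.
  apply: (@span_min B B^o); first exact: (@submodule_preZ _ _ _ (iota a) (iR _)).
  move=> _ [i [z [id Kz ->]]] /=; rewrite mulrCA -rmorphM; apply: sub_span.
  by exists i, (a * z); split=> //; exact: (@smul_in _ A^o).
have [r br] := noetherian_union nB ib bS.
exists r => x sx xJ [n rn].
have /choice[c cE] : forall i : nat, exists c : nat -> A,
  x`_i = \sum_(j < N) c j * f`_j.
  move=> i; have : J x`_i.
    have [ix|xi] := ltnP i (size x); first by apply: xJ; exact: mem_nth.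
    by rewrite nth_default //; exact: (submodule0 (submodule_span _)).
  by move=> /spanP.
have [ev [evi evT]] := BT (fun k => c (k %/ N)%N (k %% N)%N).
have evL i : (i < d)%N -> ev (L i) = x`_i.
  move=> id; rewrite rmorph_sum cE; apply: eq_bigr => j _.
  have N0 : (0 < N)%N by case: (j) => j' /=; lia.
  rewrite rmorphM evi evT; last by have := ltn_ord j; nia.
  by rewrite divnMDl // divn_small // addn0 modnMDl modn_small.
(* Modulo the kernel of [ev], the forms [L i] agree with the entries of [x], so J^(n+1) lies in
   [R n] up to kernel multiples of itself. Nakayama's lemma gives a multiplier that specialises to
   1. *)
have [g bg evg] : exists2 g, b n g & ev g = 1.
  have [s es] := nA _ (ideal_ideal_pow J n.+1).
  pose I : set B := [set g | ev g = 0].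
  have iI : ideal I.
    apply/submoduleP; split=> [|a u v /= u0 v0]; first by rewrite /I /= rmorph0.
    by rewrite /I /= rmorphD -[a *: u]/(a * u) rmorphM u0 v0 mulr0 addr0.
  have [y|g Ig gR] := @nakayama B B^o I (R n) (map iota s) iI (iR n).
    move=> /mapP[{}y ys ->]; set E := submod_span _.
    have sE : submodule E by exact: submodule_span.
    have sEi : submodule [set y : A^o | E (iota y)].
      apply/submoduleP; split=> [|a u v /= Eu Ev];
        first by rewrite /= rmorph0; exact: (submodule0 sE).
      rewrite rmorphD -[a *: u]/(a * u) rmorphM.
      by apply: (submoduleD sE) => //; exact: (submoduleZ _ sE).
    have IE a z : I a -> K n.+1 z -> E (a * iota z).
      move=> Ia; suff : K n.+1 `<=` [set z : A^o | E (a * iota z)] by apply.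
      rewrite /K es; apply: (@span_min A A^o).
        apply/submoduleP; split=> [|a' u v /= Eu Ev];
          first by rewrite /= rmorph0 mulr0; exact: (submodule0 sE).
        rewrite rmorphD -[a' *: u]/(a' * u) rmorphM mulrDr mulrCA.
        by apply: (submoduleD sE) => //; exact: (submoduleZ _ sE).
      move=> w ws; apply: sub_span; right; exists a => //; exists (iota w) =>
        //.
      by rewrite /= map_f.
    suff : K n.+1 `<=` [set y : A^o | E (iota y)].
      by apply; rewrite /K es; exact: sub_span.
    apply: subset_trans rn _; apply: smul_genl sEi _ =>
      a z /= /(nthP 0)[i ix <-] Kz.
    rewrite -[_ *: z]/(_ * z) rmorphM -[iota x`_i](subrK (L i)) mulrDl.
    apply: (submoduleD sE) => //; last first.
      by apply: sub_span; left; apply: sub_span; exists i, z; rewrite -sx.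
    rewrite cE rmorph_sum -sumrB mulr_suml.
    apply: (submodule_sum sE) => j.
    rewrite rmorphM -mulrBl -mulrA -rmorphM; apply: IE; last first.
      by apply: (@smul_in _ A^o) => //; apply: sub_span; rewrite /= mem_nth.
    have N0 : (0 < N)%N by case: (j) => j' /=; lia.
    rewrite /I /= rmorphB evi evT; last first.
      apply: (@leq_trans (i.+1 * N)); first by rewrite mulSn addnC ltn_add2r.
      by rewrite leq_mul2r -sx ix orbT.
    by rewrite divnMDl // divn_small // addn0 modnMDl modn_small // subrr.
  exists g; last by apply/esym/subr0_eq; rewrite -(rmorph1 ev) -rmorphB.
  move=> y; suff : K n.+1 `<=` [set y : A^o | R n (g * iota y)] by apply.
  rewrite /K es; apply: (@span_min A A^o).
    apply/submoduleP; split=> [|a u v /= Eu Ev];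
      first by rewrite /= rmorph0 mulr0; exact: (submodule0 (iR n)).
    rewrite rmorphD -[a *: u]/(a * u) rmorphM mulrDr mulrCA.
    by apply: (submoduleD (iR n)) => //; exact: (submoduleZ _ (iR n)).
  by move=> w ws; apply: gR; rewrite map_f.
(* Stabilisation places [g] in [b r]. Applying [ev], which sends [g] to 1 and the forms to [x],
   gives the inclusion with exponent [r]. *)
move=> y Ky; have Rgy := br n g bg y Ky.
rewrite -[y]mul1r -evg -[y]evi -rmorphM.
suff : R r `<=` [set z : B^o | smul (ideal_gen [set` x]) (K r :
  set A^o) (ev z)] by apply.
apply: (@span_min B B^o).
  apply/submoduleP; split=> [|a u v /= Eu Ev].
    by rewrite /= rmorph0; exact: (submodule0 (submodule_span _)).
  rewrite rmorphD -[a *: u]/(a * u) rmorphM.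
  by apply: (submoduleD (submodule_span _)) => //;
    exact: (submoduleZ _ (submodule_span _)).
move=> _ [i [z [id Kz ->]]] /=; rewrite rmorphM evL // evi.
by apply: (@smul_in _ A^o) => //; apply: sub_span; rewrite /= mem_nth // sx.
Qed.

End Reductions.

(** * Powers of ideals, integral dependence and reductions *)

Section Powers.
Local Open Scope ring_scope.
Import GRing.Theory.
Context {A : comNzRingType}.
Implicit Types (I J q : set A) (x f : seq A).

Lemma monomial_pred x s n : size s = size x -> sumn s = n.+1 ->
  exists a t, [/\ a \in x, size t = size x, sumn t = n &
    monomial x s = a * monomial x t].
Proof.
elim: x s => [|a x IH] [|[|k] s] //= [ss] us.
  have [b [t [bx st ut e]]] := IH s ss us.
  exists b, (0 :: t); split; rewrite ?inE ?bx ?orbT //=; first by rewrite st.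
  by rewrite !expr0 !mul1r.
exists a, (k :: s); split; rewrite ?inE ?eqxx //=; first by rewrite ss.
  by move: us; rewrite addSn => -[].
by rewrite exprS mulrA.
Qed.

Lemma monomial_succ x s a : size s = size x -> a \in x ->
  exists t, [/\ size t = size x, sumn t = (sumn s).+1 &
    monomial x t = a * monomial x s].
Proof.
elim: x s => [|b x IH] [|k s] //= [ss]; rewrite inE => /predU1P[->|ax].
  exists (k.+1 :: s); split=> /=; [by rewrite ss|by []|by rewrite exprS mulrA].
have [t [st ut e]] := IH s ss ax.
exists (k :: t); split=> /=; [by rewrite st|by rewrite ut addnS|by rewrite e mulrCA].
Qed.

Lemma iter_smul_monomials (V : lmodType A) x n (N : set V) : submodule N ->
  iter n (smul (ideal_gen [set` x])) N = submod_span
    [set monomial x s *: y | s in [set` exponents (size x) n] & y in N].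
Proof.
move=> sN; elim: n => [|n IH] /=.
  apply/esym/span_eq => // [_ [s + [y Ny <-]]|K sK NK y Ny].
    by rewrite /= mem_exponents => /andP[_ /eqP ?];
      rewrite monomial0 // scale1r.
  apply: NK; exists (nseq (size x) 0%N).
    by rewrite /= mem_exponents size_nseq sumn_nseq mul0n !eqxx.
  by exists y => //; rewrite monomial0 ?scale1r // sumn_nseq.
rewrite IH; apply/esym/span_eq; first last.
- move=> K sK NK; apply: smul_genl => // a z /= ax.
  suff : submod_span [set monomial x s *: y |
    s in [set` exponents (size x) n] & y in N]
      `<=` [set z | K (a *: z)] by apply.
  apply: span_min; first exact: submodule_preZ.
  move=> _ [s + [y Ny <-]] /=; rewrite /= mem_exponents =>
    /andP[/eqP ss /eqP us].
  have [t [st ut e]] := monomial_succ ss ax.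
  rewrite scalerA -e; apply: NK; exists t; last by exists y.
  by rewrite /= mem_exponents st ut us !eqxx.
- exact: submodule_smul.
move=> _ [s + [y Ny <-]]; rewrite /= mem_exponents => /andP[/eqP ss /eqP us].
have [a [t [ax st ut ->]]] := monomial_pred ss us.
rewrite -scalerA; apply: smul_in; apply: sub_span => //.
by exists t; [rewrite /= mem_exponents st ut !eqxx|exists y].
Qed.

Lemma ideal_powE I n : ideal_pow I n = iter n (smul (I : set A)) [set: A^o].
Proof. by elim: n => //= n ->. Qed.

Lemma smul_ideal_pow (V : lmodType A) I n :
  smul (ideal_pow I n) [set: V] = iter n (smul I) [set: V].
Proof.
elim: n => [|n IH] /=; last by rewrite -IH; exact: smulA.
by apply/seteqP; split=> // v _; rewrite -[v]scale1r; exact: smul_in.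
Qed.

Lemma submodule_iter_smul (V : lmodType A) I n (N : set V) : submodule N ->
  submodule (iter n (smul I) N).
Proof. by move=> sN; case: n => //= n; exact: submodule_smul. Qed.

Lemma iter_smul_le (V : lmodType A) I J n (N K : set V) :
  I `<=` J -> N `<=` K -> iter n (smul I) N `<=` iter n (smul J) K.
Proof. by move=> IJ NK; elim: n => //= n IH; exact: smul_le. Qed.

Lemma iter_smul_anti (V : lmodType A) I m n (N : set V) : submodule N ->
  (m <= n)%N -> iter n (smul I) N `<=` iter m (smul I) N.
Proof.
move=> sN /subnK <-; elim: (n - m)%N => [|k IH]; first exact: subset_refl.
apply: subset_trans IH; apply: smul_sub; exact: submodule_iter_smul.
Qed.

Lemma ideal_pow_scale (V : lmodType A) I k n (N : set V) a y : submodule N ->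
  ideal_pow I k a -> iter n (smul I) N y -> iter (k + n) (smul I) N (a *: y).
Proof.
move=> sN + Ny; elim: k a => [|k IH] a.
  by move=> _; apply: submoduleZ => //; exact: submodule_iter_smul.
have sP : submodule (iter (k.+1 + n) (smul I) N) by exact: submodule_iter_smul.
suff : ideal_pow I k.+1 `<=` [set a |
  iter (k.+1 + n) (smul I) N (a *: y)] by apply.
apply: (smul_min (submodule_annihilated y sP)) => u v Iu Kv /=.
by rewrite -[u *: v]/(u * v) -scalerA; apply: smul_in => //; exact: IH.
Qed.

Lemma ideal_powM J m n a b :
  ideal_pow J m a -> ideal_pow J n b -> ideal_pow J (m + n) (a * b).
Proof.
move=> Ja; rewrite !ideal_powE => Jb.
by apply: (@ideal_pow_scale A^o) => //; exact: submoduleT.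
Qed.

Lemma ideal_pow1 J : ideal J -> ideal_pow J 1 = J.
Proof.
move=> iJ; apply/seteqP; split=> [|a Ja].
  apply: (@smul_min _ A^o) => // a u Ja _; rewrite -[a *: u]/(a * u) mulrC.
  exact: (submoduleZ _ iJ).
by rewrite -[a]mulr1; exact: (@smul_in _ A^o).
Qed.

Lemma ideal_powX J n a : ideal J -> J a -> ideal_pow J n (a ^+ n).
Proof.
move=> iJ Ja; elim: n => // n IH; rewrite exprS -add1n.
by apply: ideal_powM => //; rewrite ideal_pow1.
Qed.

Lemma ideal_pow_monomial J x s : ideal J -> [set` x] `<=` J ->
  size s = size x ->
  ideal_pow J (sumn s) (monomial x s).
Proof.
move=> iJ; elim: x s => [|a x IH] [|k s] //= xJ [ss].
apply: ideal_powM; first by apply: ideal_powX => //; apply: xJ;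
  rewrite /= inE eqxx.
by apply: IH => // b bx; apply: xJ; rewrite /= inE bx orbT.
Qed.

Lemma smul_ideal_powM J q m n a b : ideal_pow J m a ->
  smul q (ideal_pow J n : set A^o) b -> smul q (ideal_pow J (m + n) :
    set A^o) (a * b).
Proof.
move=> Ja; set R := smul q (ideal_pow J (m + n) : set A^o).
have sR : submodule R by exact: submodule_smul.
suff : smul q (ideal_pow J n : set A^o) `<=` [set b : A^o | R (a * b)] by apply.
apply: (smul_min (submodule_preZ a sR)) => u v qu Jv /=.
rewrite -[a *: (u *: v)]/(a * (u * v)) mulrCA.
by apply: (@smul_in _ A^o) => //; exact: ideal_powM.
Qed.

(** Solve the integral equation for its top power: the coefficient of index [i.+1] lies in q^(i+1),
    hence in q J^i, and the accompanying power of [a] supplies the missing factors from [J]. *)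
Lemma integral_closure_pow J q a : ideal J -> ideal q -> q `<=` J -> J a ->
  integral_closure q a ->
  exists n, smul q (ideal_pow J n : set A^o) (a ^+ n.+1).
Proof.
move=> iJ iq qJ Ja [[|n] [c [//= _ qc e]]]; exists n.
set R := smul q (ideal_pow J n : set A^o).
have sR : submodule R by exact: submodule_smul.
rewrite (_ : a ^+ n.+1 = - \sum_(1 <= i < n.+2) c i * a ^+ (n.+1 - i));
  last first.
  by apply/eqP; rewrite -addr_eq0; exact/eqP.
rewrite -[- _]sub0r; apply: (submoduleB sR); first exact: (submodule0 sR).
rewrite big_nat; apply: (big_ind R); first exact: (submodule0 sR).
  by move=> *; exact: (submoduleD sR).
move=> [//|i]; rewrite !ltnS => /= ilt.
have {}qc : ideal_pow q i.+1 (c i.+1) by exact: qc.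
move: qc.
suff : smul q (ideal_pow q i : set A^o) `<=` [set b : A^o |
  R (b * a ^+ (n.+1 - i.+1))] by apply.
apply: smul_min.
  apply/submoduleP; split=> [|b u v /= Ru Rv]; first by rewrite /= mul0r;
    exact: (submodule0 sR).
  by rewrite mulrDl -[b *: u]/(b * u) -mulrA; apply: (submoduleD sR) => //;
    exact: (submoduleZ _ sR).
move=> u v qu qv /=; rewrite -[u *: v]/(u * v) -mulrA.
apply: (@smul_in _ A^o) => //; rewrite subSS -[n in ideal_pow J n](subnKC ilt).
apply: ideal_powM; last exact: ideal_powX.
by move: v qv; rewrite !ideal_powE; exact: (@iter_smul_le A^o).
Qed.

Lemma reduction_at_le J q m n : (m <= n)%N -> reduction_at J q m ->
  reduction_at J q n.
Proof.
move=> /subnK <- rm; elim: (n - m)%N => [//|k IH].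
apply: (@smul_min _ A^o); first exact: submodule_smul.
move=> a b Ja /IH; rewrite addSn; apply: (@smul_ideal_powM _ _ 1).
by rewrite -[a]mulr1; exact: (@smul_in _ A^o).
Qed.

Lemma integral_closure_reduction J q f : ideal q -> q `<=` J ->
    J = ideal_gen [set` f] -> (forall a, a \in f -> integral_closure q a) ->
  exists n, reduction_at J q n.
Proof.
move=> iq qJ eJ fq; have iJ : ideal J by rewrite eJ; exact: submodule_span.
have fJ : [set` f] `<=` J by rewrite eJ; exact: (@sub_span _ A^o).
have [n nf] : exists n, forall a, a \in f -> smul q (ideal_pow J n :
  set A^o) (a ^+ n.+1).
  elim: f {eJ} fJ fq => [|a f IH] fJ fq; first by exists 0%N.
  have [b bf|b bf|n nf] := IH; [by apply: fJ; rewrite /= inE bf orbT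
    |by apply: fq; rewrite inE bf orbT|].
  have Ja : J a by apply: fJ; rewrite /= inE eqxx.
  have [m ma] := integral_closure_pow iJ iq qJ Ja (fq a (mem_head _ _)).
  (* The two thresholds are added so that one exponent serves all generators; the surplus power
     stays in a power of [J]. *)
  exists (m + n)%N => b; rewrite inE => /predU1P[->|bf].
    by rewrite addnC -addnS exprD; apply: smul_ideal_powM => //;
      exact: ideal_powX.
  have Jb : J b by apply: fJ; rewrite /= inE bf orbT.
  by rewrite -addnS exprD; apply: smul_ideal_powM (nf _ bf); exact: ideal_powX.
(* Pigeonhole: in a monomial of large degree some generator has exponent [> n]. *)
have pigeon g s : [set` g] `<=` [set` f] -> size s = size g ->
  (size g * n < sumn s)%N ->
    smul q (ideal_pow J (sumn s).-1 : set A^o) (monomial g s).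
  elim: g s => [|a g IH] [|k s] //= gf [ss] us.
  have af : a \in f by apply: gf; rewrite /= inE eqxx.
  have gf' : [set` g] `<=` [set` f] by move=> b bg; apply: gf;
    rewrite /= inE bg orbT.
  have [nk|kn] := ltnP n k.
    rewrite mulrC -(subnK nk) exprD mulrA.
    rewrite (_ : (k - n.+1 + n.+1 + sumn s).-1 = sumn s + (k - n.+1) + n)%N;
      last by lia.
    apply: smul_ideal_powM (nf _ af); apply: ideal_powM.
      by apply: ideal_pow_monomial => //; exact: subset_trans fJ.
    by apply: ideal_powX => //; exact: fJ.
  have us' : (size g * n < sumn s)%N.
    by rewrite -(ltn_add2l n); apply: leq_trans us _; rewrite leq_add2r.
  have s0 : (0 < sumn s)%N by exact: leq_ltn_trans us'.
  rewrite (_ : (k + sumn s).-1 = k + (sumn s).-1)%N; last by lia.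
  apply: smul_ideal_powM; first by apply: ideal_powX => //; exact: fJ.
  exact: IH.
exists (size f * n)%N; rewrite /reduction_at ideal_powE {1}eJ.
rewrite (@iter_smul_monomials A^o); last exact: submoduleT.
apply: (@span_min _ A^o); first exact: submodule_smul.
move=> _ [s + [y _ <-]]; rewrite /= mem_exponents => /andP[/eqP ss /eqP us].
have := pigeon f s (@subset_refl _ _) ss; rewrite us => /(_ (ltnSn _)) /= fs.
rewrite -[_ *: y]/(_ * y) mulrC.
exact: (submoduleZ y (submodule_smul _ _) fs).
Qed.

Lemma iter_smul_reduction (V : lmodType A) J q r n : q `<=` J ->
  reduction_at J q r ->
  iter n (smul q) (iter r (smul J) [set: V]) = iter (n + r) (smul J) [set: V].
Proof.
move=> qJ rr; elim: n => //= n ->; apply/seteqP; split;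
  first exact: (smul_le qJ).
have := reduction_at_le (leq_addl n r) rr.
rewrite -!smul_ideal_pow -!smulA => rnr.
exact: (smul_le rnr).
Qed.

Lemma monomial_closed_iter_smul (V : lmodType A) I x p (N : set V) : ideal I ->
    [set` x] `<=` I -> submodule N ->
  monomial_closed x (fun n => iter (n + p) (smul I) N).
Proof.
move=> iI xI sN k n s y; rewrite mem_exponents => /andP[/eqP ss /eqP us] Ny.
rewrite -addnA; apply: ideal_pow_scale => //.
by rewrite -us; exact: ideal_pow_monomial.
Qed.

(** With q generated by [x], this makes the n-th graded piece of [growth] the quotient of q^n N by
    [Y n], whose length is the one to be estimated. *)
Lemma spread_iter_smul (V : lmodType A) x Y n (N : set V) : submodule N ->
    Y n `<=` iter n (smul (ideal_gen [set` x])) N ->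
  spread x Y N n = iter n (smul (ideal_gen [set` x])) N.
Proof.
move=> sN; rewrite iter_smul_monomials // => YN.
apply/seteqP; split; apply: span_min; try exact: submodule_span.
  by move=> z [/YN//|]; exact: sub_span.
by move=> z Nz; apply: sub_span; right.
Qed.

End Powers.

(** * Comparison of the Hilbert coefficients of two reductions *)

Section Comparison.
Local Open Scope ring_scope.
Import Order.TTheory GRing.Theory Num.Theory.
Context {A : comNzRingType} (M : lmodType A).
Implicit Types (J : set A) (e : nat -> int).

Local Notation "J ^M n" := (iter n (smul J) [set: M]) (at level 30).

(** The expansion gives finite length to M modulo a high power of [q], and that power of [q] times M
    lies inside J^k M. *)
Lemma finite_length_pow J q s e k : q `<=` J -> hilbert_expansion M q s e ->
  exists l, rel_length (J ^M k) [set: M] l.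
Proof.
move=> qJ [n0 He]; have [l + _] := He (n0 + k)%N (leq_addr _ _).
rewrite quot_lengthE smul_ideal_pow => ll.
have [|||||i [j [_ lj _]]] := rel_length_split (Y := J ^M k) _ _ _ _ _ ll.
- exact/submodule_iter_smul/submoduleT.
- exact/submodule_iter_smul/submoduleT.
- exact: submoduleT.
- apply: (@subset_trans _ (q ^M k)); last exact: iter_smul_le.
  by apply: iter_smul_anti; [exact: submoduleT|lia].
- by [].
by exists j.
Qed.

(* The lengths of [J^(n+1+r)M / q^(n+1+r)M] and [p^(n+1)M / J^(n+1+r)M] both grow
   like those of graded modules over polynomial rings, since [q] and [p] are
   reductions of [J]. *)
Lemma hilbert_expansion_compare J (x y : seq A) d r L1 L2 e e' :
    ideal J -> size x = d.+2 -> size y = d.+2 ->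
    [set` x] `<=` J -> [set` y] `<=` J ->
    reduction_at J (ideal_gen [set` x]) r ->
      reduction_at J (ideal_gen [set` y]) r ->
    rel_length (J ^M r.+1) [set: M] L1 ->
    rel_length (J ^M (r + r.+1)) [set: M] L2 ->
    hilbert_expansion M (ideal_gen [set` x]) d.+2 e ->
    hilbert_expansion M (ideal_gen [set` y]) d.+2 e' ->
  exists2 c, (c <= L1 + L2)%N &
    [/\ e 0%N = e' 0%N, - e 1%N + r%:Z * e 0%N = - e' 1%N + c%:Z &
      e' 2%N <= e 2%N - r%:Z * e 1%N + ('C(r.+1, 2))%:Z * e 0%N].
Proof.
move=> iJ sx sy xJ yJ; set q := ideal_gen [set` x]; set p := ideal_gen [set` y].
move=> rq rp lL1 lL2 [n1 He] [n2 He'].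
have sT := @submoduleT A M.
have sI (I : set A) n : submodule (I ^M n) by exact: submodule_iter_smul.
have qJ : q `<=` J by exact: (@span_min _ A^o).
have pJ : p `<=` J by exact: (@span_min _ A^o).
have xq : [set` x] `<=` q by exact: (@sub_span _ A^o).
have yp : [set` y] `<=` p by exact: (@sub_span _ A^o).
have iq : ideal q by exact: submodule_span.
have ip : ideal p by exact: submodule_span.
have redJ (I : set A) n : I `<=` J -> reduction_at J I r ->
  J ^M (n + r) `<=` I ^M n.
  by move=> IJ rI; rewrite -(iter_smul_reduction _ n IJ rI);
    exact: iter_smul_le.
(* Since J^(2r+1)M lies in q^(r+1)M, the length of J^(r+1)M / q^(r+1)M is at most [L2], whatever [q]
   is. *)
have [l2 [l2L lC]] : exists l2,
  (l2 <= L2)%N /\ rel_length (q ^M r.+1) (J ^M r.+1) l2.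
  have JqM : J ^M (r + r.+1) `<=` q ^M r.+1 by rewrite addnC; exact: redJ.
  have [i [j [_ lj e2]]] := rel_length_split (sI J _) (sI q _) sT JqM (@subsetT _ _) lL2.
  have [i' [j' [li' _ e3]]] := rel_length_split (sI q r.+1) (sI J r.+1) sT
    (iter_smul_le qJ (@subset_refl _ _)) (@subsetT _ _) lj.
  by exists i'; split=> //; lia.
have JpM : J ^M r.+1 `<=` p ^M 1 by rewrite -add1n; exact: redJ.
have [l1 [l1L lD]] : exists l1,
  (l1 <= L1)%N /\ rel_length (J ^M r.+1) (p ^M 1) l1.
  have [i [j [li _ e2]]] := rel_length_split (sI J _) (sI p _) sT JpM (@subsetT _ _) lL1.
  by exists i; split=> //; lia.
(* Here the n-th piece is q^n J^(r+1)M = J^(n+r+1)M over q^(n+r+1)M. In the second use of [growth]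
   it is p^(n+1)M over J^(n+r+1)M. *)
have [a [K [al bC]]] := growth sx (fun n => sI q (n + r.+1)%N)
  (monomial_closed_iter_smul iq xq sT) (sI J r.+1)
  (iter_smul_le qJ (@subset_refl _ _)) lC.
have [b [K' [bl bD]]] := growth sy (fun n => sI J (n + r.+1)%N)
  (monomial_closed_iter_smul iJ yJ sT) (sI p 1%N) JpM lD.
exists (a + b)%N; first by lia.
pose u i := (-1) ^+ i * e i; pose u' i := (-1) ^+ i * e' i.
have [|e0 e1 e2] := @binomial_sum_compare u u' d r (a + b) (K + K') (n1 + n2);
  last first.
- split.
  + by move: e0; rewrite /u /u' !expr0 !mul1r.
  + by move: e1; rewrite /u /u' expr0 !expr1 mul1r !mulN1r.
  + move: e2; rewrite /u /u' expr0 expr1 sqrrN expr1n !mul1r mulN1r mulrN.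
    by [].
move=> n nn; have [lx [lX aX KX]] := bC n; have [ly [lY aY KY]] := bD n.
have [|l + el] := He (n + r)%N; first by lia.
have [|l' + el'] := He' n; first by lia.
rewrite !quot_lengthE !smul_ideal_pow => ll' ll.
have rS : reduction_at J q r.+1 by exact: reduction_at_le rq.
rewrite spread_iter_smul ?(iter_smul_reduction _ n qJ rS) // in lX; last first.
  exact: iter_smul_le.
rewrite spread_iter_smul // in lY; last first.
  by rewrite -[iter n _ _]/(iter n _ (iter 1 _ _)) -iterD addn1 addnS -addSn;
    exact: redJ.
rewrite -iterD addn1 in lY; rewrite -addnS in ll.
have JpMn : J ^M (n + r.+1) `<=` p ^M n.+1 by rewrite addnS -addSn; exact: redJ.
have lp := rel_length_add (sI p _) sT JpMn (@subsetT _ _) lY ll'.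
have qJMn := iter_smul_le qJ (@subset_refl _ [set: M]).
have lq := rel_length_add (sI J _) sT (qJMn _) (@subsetT _ _) lX lp.
have ell := chain_dim_uniq ll lq.
exists (lx + ly)%N; split.
- by rewrite -[LHS]el -[binomial_sum u' _ _]el' ell !PoszD [RHS]addrC addrA.
- by rewrite mulnDl leq_add.
- by rewrite !mulnDl addnACA leq_add.
Qed.

(** Uniqueness of the dimension of M brings the expansion chosen by [xget] to the given [s]. The
    default 0 stays as a separate case and costs one extra value in the final set. *)
Lemma hilbert_coef_cases (q : set A) s i : module_dim M s -> (i <= s)%N ->
  hilbert_coef M q i = 0 \/
  exists2 e, hilbert_expansion M q s e & hilbert_coef M q i = e i.
Proof.
move=> Ms is_; rewrite /hilbert_coef; case: xgetP => [c _|_]; last by left.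
by move=> [t [e [Mt it qe ->]]]; right; exists e;
  rewrite ?(chain_dim_uniq Ms Mt).
Qed.

End Comparison.

(** * Finiteness of the set of second coefficients *)

Section Finiteness.
Local Open Scope ring_scope.
Import Order.TTheory GRing.Theory Num.Theory.

Lemma finite_set_int_between (a b : int) : finite_set [set z : int |
  a <= z <= b].
Proof.
apply: (@sub_finite_set _ _ [set a + k%:Z | k in `I_(`|b - a|.+1)%N]).
  move=> z /= /andP[az zb]; exists `|z - a|%N; last by lia.
  by rewrite /=; lia.
exact/finite_image/finite_II.
Qed.

(** Every q is compared with one reference ideal [q0] that has an expansion. The lengths [L1] and
    [L2] are taken from [q0], so all bounds are expressed by data of [q0] and [J]. *)
Lemma finite_hilbert_coef2 (A : comNzRingType) (M : lmodType A) (d : nat) (Q :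
  set A) :
    noetherian A -> ring_dim A d -> module_dim M d -> (2 <= d)%N ->
  forall m, finite_set [set hilbert_coef M q 2 | q in
    [set q | parameter_ideal m q /\ integral_closure q = integral_closure Q]].
Proof.
move=> nA dimA dimM d2 m.
pose C := [set q | parameter_ideal m q /\ integral_closure q = integral_closure Q].
have [[q0 [Cq0 [e0 He0]]]|noexp] :=
    pselect (exists q0, C q0 /\ exists e0, hilbert_expansion M q0 d e0);
      last first.
  apply: sub_finite_set (finite_set1 (0 : int)) => _ [q Cq <-] /=.
  by have [|[e qe _]] := hilbert_coef_cases q dimM d2; last by case: noexp;
    exists q; split=> //; exists e.
pose J := ideal_gen (integral_closure Q).
have iJ : ideal J by exact: submodule_span.
have [g Jg] := nA J iJ.
(* The generators of [J] are taken inside the integral closure itself, hence are integral over every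
   q of the family. *)
have [|f fQ gf] := @span_finite_seq A A^o (integral_closure Q) g.
  by move=> a ga; rewrite -/(ideal_gen _) -/J Jg; exact: (@sub_span A A^o).
have eJ : J = ideal_gen [set` f].
  apply/seteqP; split; last exact: (@span_le A A^o).
  by rewrite {1}Jg; apply: (@span_min A A^o) => //; exact: submodule_span.
have [r rJ] := uniform_reduction f d nA.
have CP q : C q -> exists x : seq A, [/\ size x = d, [set` x] `<=` J,
    reduction_at J (ideal_gen [set` x]) r & q = ideal_gen [set` x]].
  move=> [[x [dimx _] qx] cq]; have sx := chain_dim_uniq dimx dimA.
  have qcl : ideal_gen [set` x] `<=` integral_closure Q.
    rewrite -cq qx => a xa; exists 1%N, (fun=> - a); split=> //.
      move=> i i1; rewrite (_ : i = 1%N); last by lia.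
      rewrite ideal_pow1; last exact: submodule_span.
      by rewrite -[- a]sub0r; apply: (submoduleB (submodule_span _)) => //;
        exact: (submodule0 (submodule_span _)).
    by rewrite big_nat1 expr1 subnn mulr1 subrr.
  have qJ : ideal_gen [set` x] `<=` J by apply: subset_trans qcl _;
    exact: (@sub_span A A^o).
  have xJ : [set` x] `<=` J by apply: subset_trans qJ; exact: (@sub_span A A^o).
  exists x; split=> //; rewrite eJ; apply: rJ => //; first by rewrite -eJ.
  rewrite -eJ; apply: (integral_closure_reduction _ qJ eJ);
    first exact: submodule_span.
  by move=> a af; rewrite -qx cq; exact: fQ.
have [x0 [sx0 x0J red0 eq0]] := CP q0 Cq0.
have q0J : q0 `<=` J by rewrite eq0; exact: (@span_min A A^o).
have [L1 lL1] := finite_length_pow r.+1 q0J He0.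
have [L2 lL2] := finite_length_pow (r + r.+1) q0J He0.
case: d d2 dimA dimM rJ CP sx0 He0 => [//|[//|d]] d2 dimA dimM rJ CP sx0 He0.
rewrite eq0 in He0.
pose R := ('C(r.+1, 2))%:Z; pose L := (L1 + L2)%:Z.
(* [hi] comes from comparing [q0] with q. The reverse comparison bounds e_2(q) below by e_0(2) + r
   e_1(q) - R e_0(0), writing e_0(i) for the values of [e0]; there e_1(q) = e_0(1) - c' + r e_0(0)
   with c' at most [L], which gives [lo]. *)
pose lo := e0 2%N + r%:Z * (e0 1%N - L + r%:Z * e0 0%N) - R * e0 0%N.
pose hi := e0 2%N - r%:Z * e0 1%N + R * e0 0%N.
apply: (@sub_finite_set _ _ ([set 0] `|` [set z : int | lo <= z <= hi]));
  last first.
  by rewrite finite_setU; split;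
    [exact: finite_set1|exact: finite_set_int_between].
move=> _ [q Cq <-]; have [->|[e He ->]] := hilbert_coef_cases q dimM d2;
  [by left|right].
have [x [sx xJ red eq]] := CP q Cq; rewrite eq in He.
have [c _ [_ _ le_hi]] := hilbert_expansion_compare iJ sx0 sx x0J xJ red0 red lL1 lL2 He0 He.
have [c' c'L [h0 h1 le_lo]] := hilbert_expansion_compare iJ sx sx0 xJ x0J red red0 lL1 lL2 He He0.
apply/andP; split; last exact: le_hi.
move: le_lo; rewrite /lo h0 -/R => le_lo.
have {h1} h1 : e 1%N = e0 1%N - c'%:Z + r%:Z * e0 0%N by rewrite -h0; lia.
have : r%:Z * c'%:Z <= r%:Z * L by apply: ler_wpM2l => //; rewrite /L; lia.
rewrite h1 in le_lo; lia.
Qed.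

End Finiteness.

Theorem corollary3p6 (A : comNzRingType) (m : set A) (d : nat)
    (M : lmodType A) (Q : set A)
    (A_noetherian : noetherian A) (A_local : local_ring m)
    (A_complete : adically_complete m)
    (residue_infinite : infinite_set (quotient_set m))
    (dim_A : ring_dim A d)
    (M_finite : finite_module M) (dim_M : module_dim M d) (d_ge2 : (2 <= d)%N)
    (M_unmixed : unmixed M)
    (Q_parameter : parameter_ideal m Q) :
  finite_set [set hilbert_coef M q 2 | q in
    [set q | parameter_ideal m q /\ integral_closure q = integral_closure Q]].
Proof.
exact: (finite_hilbert_coef2 _ A_noetherian dim_A dim_M d_ge2).
Qed.
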